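(* Let $\Lambda$ be a row-finite $k$-graph with no sources, let $\beta\in\operatorname{Aut}(\Lambda)$ and let $\varphi\in Z^2(\Lambda\times_\beta\mathbb{Z},\mathbb{T})$. (i) There is an automorphism $\beta_\varphi$ of $C^*_{i^*(\varphi)}(\Lambda)$ such that $$\beta_\varphi(p_v)=p_{\beta v}\quad\text{and}\quad \beta_\varphi(s_e)=\varphi(\beta e,1)s_{\beta e}\quad\text{for all } v\in Q_0(\Lambda)\text{ and } e\in Q_1(\Lambda).$$ (ii) Let $(F_n)_{n\in\mathbb{N}}$ be an increasing family of finite subsets of $\Lambda^0$ such that $\bigcup_{n\in\mathbb{N}}F_n=\Lambda^0$. The sequence $\left(\sum_{v\in F_n}s_{(v,1)}\right)_{n\in\mathbb{N}}$ converges strictly to a unitary $U$ in the multiplier algebra $\mathcal{M}C^*_\varphi(\Lambda\times_\beta\mathbb{Z})$ satisfying $$Up_{(v,0)}U^*=p_{(\beta v,0)}\quad\text{and}\quad Us_{(e,0)}U^*=\varphi(\beta e,1)s_{(\beta e,0)}\quad\text{for all } v\in Q_0(\Lambda)\text{ and } e\in Q_1(\Lambda).$$ (iii) There is a homomorphism $\pi:C^*_{i^*(\varphi)}(\Lambda)\to C^*_\varphi(\Lambda\times_\beta\mathbb{Z})$ which forms a covariant pair $(\pi,U)$ (with $U$ as in (ii), for the action of $\mathbb{Z}$ generated by the automorphism $\beta_\varphi$ of (i)) whose integrated form $\pi\times U:C^*_{i^*(\varphi)}(\Lambda)\rtimes_{\beta_\varphi}\mathbb{Z}\to C^*_\varphi(\Lambda\times_\beta\mathbb{Z})$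 is an isomorphism.
   Context: $k$-graphs. A $k$-graph is a nonempty countable small category $\Lambda$ with a functor $d:\Lambda\to\mathbb{N}^k$ ($0\in\mathbb{N}$) such that whenever $d(\lambda)=m+n$ there are unique $\mu,\nu\in\Lambda$ with $d(\mu)=m$, $d(\nu)=n$, $\lambda=\mu\nu$. $\Lambda^n:=d^{-1}(n)$; $\Lambda^0$ is identified with the objects; $r,s:\Lambda\to\Lambda^0$ are the codomain and domain maps; $v\Lambda^n=\{\lambda\in\Lambda^n:r(\lambda)=v\}$. $\Lambda$ is row-finite with no sources if $0<|v\Lambda^n|<\infty$ for all $v\in\Lambda^0$, $n\in\mathbb{N}^k$. $e_1,\dots,e_k$ are the standard generators of $\mathbb{N}^k$. $\operatorname{Aut}(\Lambda)$ is the group of invertible degree-preserving functors $\Lambda\to\Lambda$. Cubes and cohomology. With $|n|=\sum_i n_i$ and $\mathbf{1}_k=\sum_i e_i$, $Q_r(\Lambda)=\{\lambda\in\Lambda:d(\lambda)\le\mathbf{1}_k,\ |d(\lambda)|=r\}$; so $Q_0(\Lambda)=\Lambda^0$ and $Q_1(\Lambda)=\bigcup_i\Lambda^{e_i}$. For $\lambda\in Q_r(\Lambda)$ with $d(\lambda)=e_{i_1}+\dots+e_{i_r}$, $i_1<\dots<i_r$, and $1\le j\le r$, $F_j^0(\lambda),F_j^1(\lambda)\in Q_{r-1}(\Lambda)$ are the unique elements for which there exist $\mu,\nu\in\Lambda^{e_{i_j}}$ with $F_j^0(\lambda)\nu=\lambda=\mu F_j^1(\lambda)$. For an abelian group $A$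 (additive notation), $C^r(\Lambda,A)$ is the group of functions $Q_r(\Lambda)\to A$, $\delta^r(f)(\lambda)=\sum_{j=1}^{r+1}\sum_{\ell=0}^1(-1)^{j+\ell}f(F_j^\ell(\lambda))$ for $\lambda\in Q_{r+1}(\Lambda)$, and $Z^r(\Lambda,A)=\ker\delta^r$. For $A=\mathbb{T}$ (unit circle) multiplicative notation is used. Crossed product graph. $\Lambda\times_\beta\mathbb{Z}$ is the (row-finite, no sources) $(k+1)$-graph with morphisms $\Lambda\times\mathbb{N}$, $r(\lambda,n)=(r(\lambda),0)$, $s(\lambda,n)=(\beta^{-n}(s(\lambda)),0)$, $d(\lambda,n)=(d(\lambda),n)$, composition $(\lambda,m)(\mu,n)=(\lambda\beta^m(\mu),m+n)$. Its cubes are $Q_0=Q_0(\Lambda)\times\{0\}$ and $Q_{r+1}(\Lambda\times_\beta\mathbb{Z})=\{(\lambda,1):\lambda\in Q_r(\Lambda)\}\cup\{(\lambda,0):\lambda\in Q_{r+1}(\Lambda)\}$. For $\varphi\in Z^2(\Lambda\times_\beta\mathbb{Z},\mathbb{T})$, $i^*(\varphi)\in Z^2(\Lambda,\mathbb{T})$ is $i^*(\varphi)(\lambda)=\varphi(\lambda,0)$. Twisted algebras. For a row-finite $k$-graph $\Lambda$ with no sources and $\varphi\in Z^2(\Lambda,\mathbb{T})$, a Cuntz–Krieger $\varphi$-representation of $\Lambda$ in a $C^*$-algebra $A$ consists of mutually orthogonal projections $\{p_v:v\in\Lambda^0\}\subseteq A$ and elements $\{s_\lambda:\lambda\in Q_1(\Lambda)\}\subseteq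 A$ such that: (TG1) $s_\lambda^*s_\lambda=p_{s(\lambda)}$ for all $1\le i\le k$, $\lambda\in\Lambda^{e_i}$; (TG2) for $1\le i<j\le k$ and $\mu,\mu'\in\Lambda^{e_i}$, $\nu,\nu'\in\Lambda^{e_j}$ with $\mu\nu=\nu'\mu'$, $s_{\nu'}s_{\mu'}=\varphi(\mu\nu)s_\mu s_\nu$; (TG3) $p_v=\sum_{\lambda\in v\Lambda^{e_i}}s_\lambda s_\lambda^*$ for all $v\in\Lambda^0$ and $i$ with $v\Lambda^{e_i}\neq\emptyset$. $C^*_\varphi(\Lambda)$ is the universal $C^*$-algebra generated by a Cuntz–Krieger $\varphi$-representation, and $p_v,s_\lambda$ denote its universal generators (in $C^*_\varphi(\Lambda\times_\beta\mathbb{Z})$ these are $p_{(v,0)}$, $s_{(e,0)}$, $s_{(v,1)}$ for $v\in\Lambda^0$, $e\in Q_1(\Lambda)$). $\mathcal{M}B$ denotes the multiplier algebra of a $C^*$-algebra $B$. *)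

(* Defs.v *)
From HB Require Import structures.
From mathcomp Require Import all_boot all_order all_algebra.
From mathcomp Require Import finmap.
From mathcomp Require Import complex.
From mathcomp Require Import all_classical all_reals all_analysis.

Set Implicit Arguments.
Unset Strict Implicit.
Unset Printing Implicit Defensive.

Import Order.TTheory GRing.Theory Num.Theory.
Import numFieldNormedType.Exports.

Local Open Scope classical_set_scope.
Local Open Scope ring_scope.

(* Addition and 0 on the degrees {ffun 'I_k -> nat}, i.e. N^k, are pointwise.
   Objects and morphisms are kept apart, so Lambda^0 is [kob].  Composition is
   a total function, whose value is meaningful only when ksrc x = krng y. *)
Record kgraph (k : nat) := KGraph {
  kob : countType;
  kmor :> countType;
  krng : kmor -> kob;
  ksrc : kmor -> kob;
  kid : kob -> kmor;
  kcompose : kmor -> kmor -> kmor;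
  kdeg : kmor -> {ffun 'I_k -> nat};
  kob_nonempty : inhabited kob;
  krng_id : forall v, krng (kid v) = v;
  ksrc_id : forall v, ksrc (kid v) = v;
  krng_comp : forall x y, ksrc x = krng y -> krng (kcompose x y) = krng x;
  ksrc_comp : forall x y, ksrc x = krng y -> ksrc (kcompose x y) = ksrc y;
  kcomposeA : forall x y z, ksrc x = krng y -> ksrc y = krng z ->
    kcompose x (kcompose y z) = kcompose (kcompose x y) z;
  kcompose_idl : forall x, kcompose (kid (krng x)) x = x;
  kcompose_idr : forall x, kcompose x (kid (ksrc x)) = x;
  kdeg_id : forall v, kdeg (kid v) = 0;
  kdeg_comp : forall x y, ksrc x = krng y ->
    kdeg (kcompose x y) = kdeg x + kdeg y;
  kfactor : forall x m n, kdeg x = m + n ->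
    exists! yz : kmor * kmor,
      [/\ kdeg yz.1 = m, kdeg yz.2 = n, ksrc yz.1 = krng yz.2
        & kcompose yz.1 yz.2 = x]
}.

Arguments kid {k} _ _.

Section KGraphTheory.
Variables (k : nat) (L : kgraph k).

Definition paths_from (v : kob L) (n : {ffun 'I_k -> nat}) : set L :=
  [set x | krng x = v /\ kdeg x = n].

Definition row_finite_no_sources : Prop :=
  forall v n, finite_set (paths_from v n) /\ paths_from v n !=set0.

Definition unitdeg (i : 'I_k) : {ffun 'I_k -> nat} :=
  [ffun j => (j == i : nat)].

Definition cubes (r : nat) : set L :=
  [set x | (forall i, (kdeg x i <= 1)%N) /\ (\sum_(i < k) kdeg x i)%N = r].

Definition is_factorization (x : L) (yz : L * L) : Prop :=
  ksrc yz.1 = krng yz.2 /\ kcompose yz.1 yz.2 = x.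

(* If d(x) = e_{i_1} + ... + e_{i_r} with i_1 < ... < i_r, then F_j^0(x) and
   F_j^1(x) are [face0 i_j x] and [face1 i_j x], and j is [dirpos x i_j]. *)
Definition face0 (i : 'I_k) (x : L) : L :=
  (xget (x, x)
    [set yz | is_factorization x yz /\ kdeg yz.2 = unitdeg i]).1.

Definition face1 (i : 'I_k) (x : L) : L :=
  (xget (x, x)
    [set yz | is_factorization x yz /\ kdeg yz.1 = unitdeg i]).2.

Definition face (l : nat) : 'I_k -> L -> L := if l == 0%N then face0 else face1.

Definition dirpos (x : L) (i : 'I_k) : nat :=
  #|[set j : 'I_k | (j <= i)%N && (kdeg x j != 0%N)]|.

Variable R : realType.

(* Multiplicative coboundary.  A cochain on r-cubes is a function on all
   morphisms, of which only the values on [cubes r] matter. *)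
Definition coboundary (f : L -> R[i]) (x : L) : R[i] :=
  \prod_(i < k | kdeg x i != 0%N) \prod_(l < 2)
    f (face l i x) ^ ((-1) ^+ (dirpos x i + l) : int).

(* Z^r(L, T), with T the unit circle of C = R[i] *)
Definition cocycle (r : nat) (f : L -> R[i]) : Prop :=
  (forall x, cubes r x -> `|f x| = 1) /\
  (forall x, cubes r.+1 x -> coboundary f x = 1).

End KGraphTheory.

Record kauto (k : nat) (L : kgraph k) := KAuto {
  aob : kob L -> kob L;
  amor :> L -> L;
  aobV : kob L -> kob L;
  amorV : L -> L;
  aobK : cancel aob aobV;
  aobVK : cancel aobV aob;
  amorK : cancel amor amorV;
  amorVK : cancel amorV amor;
  amor_rng : forall x, krng (amor x) = aob (krng x);
  amor_src : forall x, ksrc (amor x) = aob (ksrc x);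
  amor_id : forall v, amor (kid L v) = kid L (aob v);
  amor_comp : forall x y, ksrc x = krng y ->
    amor (kcompose x y) = kcompose (amor x) (amor y);
  amor_deg : forall x, kdeg (amor x) = kdeg x
}.

Section CrossedProductGraph.
Variables (k : nat) (L : kgraph k) (b : kauto L).

(* (m, n) in N^k x N = N^(k+1), with n in the last coordinate *)
Definition degpair (m : {ffun 'I_k -> nat}) (n : nat) : {ffun 'I_k.+1 -> nat} :=
  [ffun i => if unlift ord_max i is Some j then m j else n].

Let xmor : countType := (L * nat)%type.
Let xrng (x : xmor) : kob L := krng x.1.
Let xsrc (x : xmor) : kob L := iter x.2 (aobV b) (ksrc x.1).
Let xid (v : kob L) : xmor := (kid L v, 0%N).
Let xcomp (x y : xmor) : xmor := (kcompose x.1 (iter x.2 b y.1), (x.2 + y.2)%N).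
Let xdeg (x : xmor) := degpair (kdeg x.1) x.2.

Let iter_rng n x : krng (iter n b x) = iter n (aob b) (krng x).
Proof. by elim: n => //= n IH; rewrite amor_rng IH. Qed.

Let iter_src n x : ksrc (iter n b x) = iter n (aob b) (ksrc x).
Proof. by elim: n => //= n IH; rewrite amor_src IH. Qed.

Let iter_deg n x : kdeg (iter n b x) = kdeg x.
Proof. by elim: n => //= n IH; rewrite amor_deg IH. Qed.

Let iter_id n v : iter n b (kid L v) = kid L (iter n (aob b) v).
Proof. by elim: n => //= n IH; rewrite IH amor_id. Qed.

Let iter_comp n x y : ksrc x = krng y ->
  iter n b (kcompose x y) = kcompose (iter n b x) (iter n b y).
Proof.
by move=> e; elim: n => //= n ->; rewrite amor_comp // iter_src iter_rng e.
Qed.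

Let iterK T (f g : T -> T) : cancel f g -> forall n, cancel (iter n f) (iter n g).
Proof. by move=> fK; elim=> // n IH x; rewrite [LHS]iterSr iterS fK IH. Qed.

Let xcomposable x y : xsrc x = xrng y <-> ksrc x.1 = krng (iter x.2 b y.1).
Proof.
rewrite iter_rng /xsrc /xrng; split=> [<-|->].
  by rewrite (iterK (aobVK b)).
by rewrite (iterK (aobK b)).
Qed.

Let degpairD m n m' n' :
  degpair m n + degpair m' n' = degpair (m + m') (n + n').
Proof. by apply/ffunP => i; rewrite !ffunE; case: unliftP => *; rewrite ?ffunE. Qed.

Let degpair_inj m n m' n' : degpair m n = degpair m' n' -> m = m' /\ n = n'.
Proof.
move=> /ffunP e; split.
  by apply/ffunP => j; have := e (lift ord_max j); rewrite !ffunE liftK.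
by have := e ord_max; rewrite !ffunE unlift_none.
Qed.

Let degpair_surj d : exists m n, d = degpair m n.
Proof.
exists [ffun j => d (lift ord_max j)], (d ord_max).
by apply/ffunP => i; rewrite !ffunE; case: unliftP => [j|] ->; rewrite ?ffunE.
Qed.

Let xrng_id v : xrng (xid v) = v. Proof. exact: krng_id. Qed.
Let xsrc_id v : xsrc (xid v) = v. Proof. exact: ksrc_id. Qed.

Let xrng_comp x y : xsrc x = xrng y -> xrng (xcomp x y) = xrng x.
Proof. by move=> /xcomposable e; rewrite /xrng /= krng_comp. Qed.

Let xsrc_comp x y : xsrc x = xrng y -> xsrc (xcomp x y) = xsrc y.
Proof.
move=> /xcomposable e; rewrite /xsrc /= ksrc_comp // iter_src.
by rewrite addnC iterD (iterK (aobK b)).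
Qed.

Let xcompA x y z : xsrc x = xrng y -> xsrc y = xrng z ->
  xcomp x (xcomp y z) = xcomp (xcomp x y) z.
Proof.
move=> /xcomposable e /xcomposable f; rewrite /xcomp /= addnA; congr pair.
by rewrite iter_comp // iterD kcomposeA // iter_src f -iter_rng.
Qed.

Let xcomp_idl x : xcomp (xid (xrng x)) x = x.
Proof. by case: x => x n; rewrite /xcomp /= kcompose_idl. Qed.

Let xcomp_idr x : xcomp x (xid (xsrc x)) = x.
Proof.
case: x => x n; rewrite /xcomp /xsrc /= addn0 iter_id (iterK (aobVK b)).
by rewrite kcompose_idr.
Qed.

Let xdeg_id v : xdeg (xid v) = 0.
Proof.
by apply/ffunP => i; rewrite !ffunE /= kdeg_id; case: unliftP => *; rewrite ?ffunE.
Qed.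

Let xdeg_comp x y : xsrc x = xrng y -> xdeg (xcomp x y) = xdeg x + xdeg y.
Proof.
by move=> /xcomposable e; rewrite /xdeg degpairD kdeg_comp // iter_deg.
Qed.

Let xfactor x m n : xdeg x = m + n ->
  exists! yz : xmor * xmor,
    [/\ xdeg yz.1 = m, xdeg yz.2 = n, xsrc yz.1 = xrng yz.2
      & xcomp yz.1 yz.2 = x].
Proof.
have [m1 [m2 ->]] := degpair_surj m; have [n1 [n2 ->]] := degpair_surj n.
case: x => x q; rewrite degpairD => /degpair_inj[/= dx ->].
have [[y z] [[/= dy dz syz cyz] uniq_yz]] := kfactor dx.
exists ((y, m2), (iter m2 (amorV b) z, n2)); split.
  split => //=.
  - by rewrite /xdeg /= dy.
  - by rewrite /xdeg /= -(iter_deg m2 (iter _ _ _)) (iterK (amorVK b)) dz.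
  - by apply/xcomposable; rewrite /= (iterK (amorVK b)).
  - by rewrite /xcomp /= (iterK (amorVK b)) cyz.
case=> [[y' a] [z' c]] [/= /degpair_inj[/= dy' ea] /degpair_inj[/= dz' ec]].
move=> /xcomposable /= s' [c' _].
have := uniq_yz (y', iter a b z').
rewrite /= iter_deg => /(_ (And4 dy' dz' s' c')) [-> ->].
by rewrite ea ec (iterK (amorK b)).
Qed.

(* The object v of [xprod] stands for (v, 0). *)
Definition xprod : kgraph k.+1 :=
  @KGraph k.+1 (kob L) xmor xrng xsrc xid xcomp xdeg (kob_nonempty L)
    xrng_id xsrc_id xrng_comp xsrc_comp xcompA xcomp_idl xcomp_idr
    xdeg_id xdeg_comp xfactor.

Definition ipull (R : realType) (phi : xprod -> R[i]) : L -> R[i] :=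
  fun x => phi (x, 0%N).

End CrossedProductGraph.

HB.mixin Record isCStarAlgebra (R : realType) A
    of CompleteNormedModule R[i] A := {
  cmul : A -> A -> A;
  cstar : A -> A;
  cmulA : forall x y z, cmul x (cmul y z) = cmul (cmul x y) z;
  cmulDl : forall x y z, cmul (x + y) z = cmul x z + cmul y z;
  cmulDr : forall x y z, cmul x (y + z) = cmul x y + cmul x z;
  cmulZl : forall (c : R[i]) x y, cmul (c *: x) y = c *: cmul x y;
  cmulZr : forall (c : R[i]) x y, cmul x (c *: y) = c *: cmul x y;
  cstarK : forall x, cstar (cstar x) = x;
  cstarD : forall x y, cstar (x + y) = cstar x + cstar y;
  cstarZ : forall (c : R[i]) x, cstar (c *: x) = c^* *: cstar x;
  cstarM : forall x y, cstar (cmul x y) = cmul (cstar y) (cstar x);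
  cnormM : forall x y, `|cmul x y| <= `|x| * `|y|;
  cnorm_star : forall x, `|cmul (cstar x) x| = `|x| ^+ 2
}.

#[short(type="cstarAlgType")]
HB.structure Definition CStarAlgebra (R : realType) :=
  { A of isCStarAlgebra R A & CompleteNormedModule R[i] A }.

Declare Scope cstar_scope.
Delimit Scope cstar_scope with CS.
Notation "x ** y" := (cmul x y) (at level 40, left associativity) : cstar_scope.
Notation "x ^#" := (cstar x) (at level 2, format "x ^#") : cstar_scope.
Local Open Scope cstar_scope.

Section CStarTheory.
Variable R : realType.
Implicit Types A B C D : cstarAlgType R.

Definition star_hom A B (f : A -> B) : Prop :=
  [/\ forall x y, f (x + y) = f x + f y,
      forall (c : R[i]) x, f (c *: x) = c *: f x,
      forall x y, f (x ** y) = f x ** f y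
    & forall x, f x^# = (f x)^#].

Definition star_iso A B (f : A -> B) : Prop := star_hom f /\ bijective f.

Definition closed_star_subalgebra A (S : set A) : Prop :=
  [/\ closed S, S 0, forall x y, S x -> S y -> S (x + y),
      forall (c : R[i]) x, S x -> S (c *: x)
    & (forall x y, S x -> S y -> S (x ** y)) /\ (forall x, S x -> S x^#)].

Definition generated_by A (G : set A) : Prop :=
  forall S : set A, closed_star_subalgebra S -> G `<=` S -> S = setT.

Definition is_projection A (x : A) : Prop := x^# = x /\ x ** x = x.

(* Multipliers as double centralizers: [mleft T x] is T x and [mright T x] is
   x T.  Both maps are automatically linear and bounded. *)
Record multiplier A := Multiplier {
  mleft : A -> A;
  mright : A -> A;
  multiplierP : forall x y, x ** mleft y = mright x ** y
}.

Section Multipliers.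
Variable A : cstarAlgType R.
Implicit Types T U : multiplier A.

Definition mult_one : multiplier A :=
  @Multiplier A id id (fun _ _ => erefl).

Let mult_mul_subproof T U x y :
  x ** mleft T (mleft U y) = mright U (mright T x) ** y.
Proof. by rewrite multiplierP multiplierP. Qed.

Definition mult_mul T U : multiplier A :=
  @Multiplier A (mleft T \o mleft U) (mright U \o mright T)
    (mult_mul_subproof T U).

Let mult_star_subproof T x y :
  x ** (mright T y^#)^# = (mleft T x^#)^# ** y.
Proof.
by apply: (can_inj cstarK); rewrite !cstarM !cstarK multiplierP.
Qed.

Definition mult_star T : multiplier A :=
  @Multiplier A (fun x => (mright T x^#)^#) (fun x => (mleft T x^#)^#)
    (mult_star_subproof T).

(* the canonical embedding of A in M(A) *)
Definition mult_of (a : A) : multiplier A :=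
  @Multiplier A (fun x => a ** x) (fun x => x ** a)
    (fun x y => cmulA x a y).

Definition mult_unitary U : Prop :=
  mult_mul (mult_star U) U = mult_one /\ mult_mul U (mult_star U) = mult_one.

(* U^n for n in Z, when U is unitary *)
Definition mult_pow U (n : int) : multiplier A :=
  match n with
  | Posz m => iter m (mult_mul U) mult_one
  | Negz m => iter m.+1 (mult_mul (mult_star U)) mult_one
  end.

Definition mult_conj U T : multiplier A := mult_mul (mult_mul U T) (mult_star U).

Definition strict_cvg (T : nat -> multiplier A) U : Prop :=
  forall a : A, ((fun n => mleft (T n) a) @ \oo --> mleft U a) /\
                ((fun n => mright (T n) a) @ \oo --> mright U a).

End Multipliers.

(* covariant pair for the action of Z on A generated by the automorphism alpha *)
Definition covariant_pair A C (alpha : A -> A) (pi : A -> C) (U : multiplier C)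
  : Prop :=
  [/\ star_hom pi, mult_unitary U
    & forall a, mult_conj U (mult_of (pi a)) = mult_of (pi (alpha a))].

(* Given a crossed product D with canonical maps jA : A -> D and u in M(D),
   f is the integrated form pi x U : jA(a) u^n |-> pi(a) U^n. *)
Definition integrated_form A D C (jA : A -> D) (u : multiplier D)
    (pi : A -> C) (U : multiplier C) (f : D -> C) : Prop :=
  star_hom f /\
  forall (a : A) (n : int),
    f (mright (mult_pow u n) (jA a)) = mright (mult_pow U n) (pi a).

(* D, with jA and u, is the crossed product of A by the action of Z generated
   by alpha: it is the universal algebra for covariant pairs, and the image of
   C_c(Z, A) is dense in it. *)
Definition is_crossed_product A (alpha : A -> A) D (jA : A -> D)
    (u : multiplier D) : Prop :=
  [/\ covariant_pair alpha jA u,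
      dense (range (fun w : seq (A * int) =>
        \sum_(x <- w) mright (mult_pow u x.2) (jA x.1)))
    & forall C (pi : A -> C) (U : multiplier C), covariant_pair alpha pi U ->
        exists f : D -> C, integrated_form jA u pi U f].

Section TwistedAlgebras.
Variables (k : nat) (L : kgraph k) (phi : L -> R[i]).

(* The values of s outside the 1-cubes are irrelevant. *)
Definition ck_rep A (p : kob L -> A) (s : L -> A) : Prop :=
  [/\ (forall v, is_projection (p v)) /\
      (forall v w, v != w -> p v ** p w = 0),
      forall x, cubes 1 x -> (s x)^# ** s x = p (ksrc x),
      forall (i j : 'I_k) (mu mu' nu nu' : L), (i < j)%N ->
        kdeg mu = unitdeg i -> kdeg mu' = unitdeg i ->
        kdeg nu = unitdeg j -> kdeg nu' = unitdeg j ->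
        ksrc mu = krng nu -> ksrc nu' = krng mu' ->
        kcompose mu nu = kcompose nu' mu' ->
        s nu' ** s mu' = phi (kcompose mu nu) *: (s mu ** s nu)
    & forall v (i : 'I_k), paths_from v (unitdeg i) !=set0 ->
        p v = \sum_(x \in paths_from v (unitdeg i)) s x ** (s x)^#].

(* A, with p and s, is the twisted algebra C^*_phi(L) *)
Definition is_twisted_algebra A (p : kob L -> A) (s : L -> A) : Prop :=
  [/\ ck_rep p s,
      generated_by (range p `|` s @` cubes 1)
    & forall C (q : kob L -> C) (t : L -> C), ck_rep q t ->
        exists f : A -> C, [/\ star_hom f, forall v, f (p v) = q v
          & forall x, cubes 1 x -> f (s x) = t x]].

End TwistedAlgebras.

End CStarTheory.

Definition exhausting (T : choiceType) (F : nat -> {fset T}) : Prop :=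
  {homo F : m n / (m <= n)%N >-> (m `<=` n)%fset} /\
  forall v, exists n, v \in F n.

Section InducedAutomorphism.
Variables (R : realType) (k : nat) (L : kgraph k) (b : kauto L).
Variables (phi : xprod b -> R[i]) (A : cstarAlgType R).
Variables (p : kob L -> A) (s : L -> A).

Definition is_beta_phi (f : A -> A) : Prop :=
  [/\ star_iso f, forall v, f (p v) = p (aob b v)
    & forall e, cubes 1 e -> f (s e) = phi (b e, 1%N) *: s (b e)].

End InducedAutomorphism.

(* Main.v *)
Require Import Defs.
From mathcomp Require Import all_boot all_order all_algebra.
From mathcomp Require Import finmap.
From mathcomp Require Import complex.
From mathcomp Require Import ring.
From mathcomp Require Import all_classical all_reals all_analysis.

Set Implicit Arguments.
Unset Strict Implicit.
Unset Printing Implicit Defensive.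

Import Order.TTheory GRing.Theory Num.Theory.
Import numFieldNormedType.Exports.

Local Open Scope classical_set_scope.
Local Open Scope ring_scope.
Local Open Scope cstar_scope.

(** Write T_v for the generator of B at the edge (v, 1) of the product graph.
    These are partial isometries with T_v T_v^* = q_v and
    T_v^* T_v = q_(b^-1 v), and the square (b e, 1) makes
    T_(b r(e)) t_e equal to phi(b e, 1) t_(b e) T_(b s(e)).  So the formal sum
    U of all T_v is a unitary that implements the automorphism, and B is
    generated by a copy of A and its multiples by U, subject to nothing but
    covariance.

    The automorphism exists because the translated and rescaled family
    satisfies the relations of A; for the squares this is the cocycle identity
    on the cube (b x, 1) (cocycle_cube).  The same construction for the
    inverse of b, with conjugate weights, gives the inverse.

    The partial sums of U are contractions which are eventually constant when
    multiplied by a generator, so they converge strictly; their products with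
    their adjoints are sums of vertex projections, which form an approximate
    identity (ck_approximate_identity), so the limit is unitary.

    For the isomorphism, v |-> jA(p_v), e |-> jA(s_e), (v, 1) |-> jA(p_v) u is
    a representation in the crossed product D of the relations of B
    (dual_ck_rep).  It yields a map B -> D inverse to the integrated form: the
    two composites are the identity on generators, once it is known that the
    map carries multiplication by U to multiplication by u
    (dual_hom_unitary).

    The argument rests on two analytic facts.  A *-homomorphism is contractive
    (star_hom_norm), so that it is determined by its values on generators.
    Projections whose sum is a projection are dominated by it
    (projection_summand), so that q_v t_e = t_e for an edge e with range v.
    Both are obtained without spectral theory from the square root of 1 - a
    for |a| < 1 (one_minus_sqrt) and from the estimate
    |x|^2 <= |x^* x + y^* y| when x^* y is self-adjoint (norm_pythagoras). *)

(** * Limits in normed modules *)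

Section NormedLimits.
Variable K : numFieldType.

Section Filters.
Context {T : Type} {F : set_system T} {FF : Filter F}.

(** Domination by a null sequence. Over a field that need not be ordered
    totally, this takes the place of squeezing between two limits. *)
Lemma cvg_dominated (V : normedModType K) (f : T -> V) (l : V) (h : T -> K) :
  (forall i, `|l - f i| <= h i) -> h i @[i --> F] --> (0 : K) ->
  f i @[i --> F] --> l.
Proof.
move=> fh h0; apply/cvgrPdist_lt => e e0.
have /cvgrPdist_lt/(_ e e0) := h0.
apply: filterS => i; rewrite sub0r normrN => he.
apply: le_lt_trans he; rewrite ger0_norm ?fh //.
exact: le_trans (fh i).
Qed.

Lemma cvg_dist0 (V : normedModType K) (f : T -> V) (l : V) :
  f i @[i --> F] --> l -> `|l - f i| @[i --> F] --> (0 : K).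
Proof.
move=> fl; apply/norm_cvg0P; rewrite -(subrr l).
by apply: cvgB => //; exact: cvg_cst.
Qed.

Lemma cvg_bounded_bilinear (U V W : normedModType K) (m : U -> V -> W)
    (f : T -> U) (g : T -> V) a b :
  (forall x y z, m (x - y) z = m x z - m y z) ->
  (forall x y z, m x (y - z) = m x y - m x z) ->
  (forall x y, `|m x y| <= `|x| * `|y|) ->
  f i @[i --> F] --> a -> g i @[i --> F] --> b ->
  m (f i) (g i) @[i --> F] --> m a b.
Proof.
move=> mBl mBr mM fa gb.
pose h i := `|a - f i| * `|g i| + `|a| * `|b - g i|.
apply: (@cvg_dominated _ _ _ h) => [i|].
  have -> : m a b - m (f i) (g i) = m (a - f i) (g i) + m a (b - g i).
    by rewrite mBl mBr [RHS]addrC addrA subrK.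
  by apply: (le_trans (ler_normD _ _)); rewrite lerD.
have -> : 0 = 0 * `|b| + `|a| * 0 :> K by rewrite mul0r mulr0 addr0.
apply: cvgD; apply: cvgM.
- exact: cvg_dist0.
- exact: cvg_norm.
- exact: cvg_cst.
- exact: cvg_dist0.
Qed.

End Filters.

Lemma closed_coincidence (V W : normedModType K) (f g : V -> W) :
  continuous f -> continuous g -> closed [set x | f x = g x].
Proof.
move=> cf cg x clx; apply: contrapT => ne.
have d0 : 0 < `|f x - g x| / 2 by rewrite divr_gt0 // normr_gt0 subr_eq0; apply/eqP.
have /cvgrPdist_lt/(_ _ d0) nf := cf x.
have /cvgrPdist_lt/(_ _ d0) ng := cg x.
have [y [/= e [fy gy]]] := clx _ (filterI nf ng).
move: (ltrD fy gy); rewrite -splitr e.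
by rewrite [X in _ + X]distrC => /le_lt_trans - /(_ _ (ler_distD _ _ _)); rewrite ltxx.
Qed.

Lemma continuous_bound (V W : normedModType K) (f : V -> W) (c : K) :
  (forall x y, `|f x - f y| <= c * `|x - y|) -> continuous f.
Proof.
move=> H x; apply: (@cvg_dominated _ _ _ _ _ _ (fun y => c * `|x - y|)) => //.
rewrite -[0](mulr0 c); apply: cvgM; first exact: cvg_cst.
by apply: cvg_dist0; exact: cvg_id.
Qed.

End NormedLimits.

(** * Algebra and topology of C*-algebras *)

Section CStarBasics.
Variables (R : realType) (A : cstarAlgType R).
Implicit Types (x y z a b : A) (c : R[i]).

Lemma cmul0x x : 0 ** x = 0.
Proof. by rewrite -[X in X ** x](scale0r (0 : A)) cmulZl scale0r. Qed.

Lemma cmulx0 x : x ** 0 = 0.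
Proof. by rewrite -[X in x ** X](scale0r (0 : A)) cmulZr scale0r. Qed.

Lemma cmulNx x y : (- x) ** y = - (x ** y).
Proof. by rewrite -scaleN1r cmulZl scaleN1r. Qed.

Lemma cmulxN x y : x ** (- y) = - (x ** y).
Proof. by rewrite -scaleN1r cmulZr scaleN1r. Qed.

Lemma cmulBl x y z : (x - y) ** z = x ** z - y ** z.
Proof. by rewrite cmulDl cmulNx. Qed.

Lemma cmulBr x y z : x ** (y - z) = x ** y - x ** z.
Proof. by rewrite cmulDr cmulxN. Qed.

Lemma cmul_suml I (r : seq I) (P : pred I) (F : I -> A) x :
  (\sum_(i <- r | P i) F i) ** x = \sum_(i <- r | P i) F i ** x.
Proof.
apply: (big_morph (fun y => y ** x)); last exact: cmul0x.
by move=> y z; rewrite cmulDl.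
Qed.

Lemma cmul_sumr I (r : seq I) (P : pred I) (F : I -> A) x :
  x ** (\sum_(i <- r | P i) F i) = \sum_(i <- r | P i) x ** F i.
Proof.
by apply: (big_morph (cmul x)); [move=> y z; rewrite cmulDr | exact: cmulx0].
Qed.

Lemma cstar0 : (0 : A)^# = 0.
Proof. by rewrite -[X in X^#](scale0r (0 : A)) cstarZ rmorph0 scale0r. Qed.

Lemma cstarN x : (- x)^# = - x^#.
Proof. by rewrite -scaleN1r cstarZ rmorphN rmorph1 scaleN1r. Qed.

Lemma cstarB x y : (x - y)^# = x^# - y^#.
Proof. by rewrite cstarD cstarN. Qed.

Lemma cstar_sum I (r : seq I) (P : pred I) (F : I -> A) :
  (\sum_(i <- r | P i) F i)^# = \sum_(i <- r | P i) (F i)^#.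
Proof. by apply: (big_morph cstar); [exact: cstarD | exact: cstar0]. Qed.

Lemma normc_star x : `|x^#| = `|x|.
Proof.
have le y : `|y| <= `|y^#|.
  have [->|y0] := eqVneq y 0; first by rewrite normr0 normr_ge0.
  have ny : 0 < `|y| by rewrite normr_gt0.
  by rewrite -(ler_pM2r ny) -expr2 -cnorm_star cnormM.
by apply/eqP; rewrite eq_le le -{2}[x]cstarK le.
Qed.

Lemma cstar_mul_eq0 x : x^# ** x = 0 -> x = 0.
Proof.
move=> e; apply/eqP; rewrite -normr_eq0.
by have := cnorm_star x; rewrite e normr0 => /esym/eqP; rewrite sqrf_eq0.
Qed.

(** Since x x^* vanishes only for x = 0, multiplication is nondegenerate; in
    the absence of a unit, identities are tested on all products. *)
Lemma cmul_faithful x y : (forall z, x ** z = y ** z) -> x = y.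
Proof.
move=> e; apply/eqP; rewrite -subr_eq0; apply/eqP/(can_inj cstarK).
by rewrite cstar0; apply: cstar_mul_eq0; rewrite cstarK cmulBl e subrr.
Qed.

Lemma projection_norm x : is_projection x -> `|x| <= 1.
Proof.
case=> e xx; have [->|x0] := eqVneq x 0; first by rewrite normr0 ler01.
have nx : 0 < `|x| by rewrite normr_gt0.
by rewrite -(ler_pM2r nx) -expr2 -cnorm_star e xx mul1r.
Qed.

Lemma norm_eq_star_mul x y : x^# ** x = y^# ** y -> `|x| = `|y|.
Proof.
move=> e; apply/eqP; rewrite -(@eqrXn2 _ 2) ?normr_ge0 //.
by rewrite -!cnorm_star e.
Qed.

Section Limits.
Context {T : Type} {F : set_system T} {FF : Filter F}.

Lemma cvg_cmul (f g : T -> A) a b :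
  f i @[i --> F] --> a -> g i @[i --> F] --> b ->
  f i ** g i @[i --> F] --> a ** b.
Proof.
apply: cvg_bounded_bilinear; [exact: cmulBl | exact: cmulBr | exact: cnormM].
Qed.

Lemma cvg_cstar (f : T -> A) a :
  f i @[i --> F] --> a -> (f i)^# @[i --> F] --> a^#.
Proof.
move=> fa; apply: (@cvg_dominated _ _ _ _ _ _ _ (fun i => `|a - f i|)).
  by move=> i; rewrite -cstarB normc_star.
exact: cvg_dist0.
Qed.

End Limits.

Lemma continuous_cmull a : continuous (cmul a).
Proof. by move=> x; apply: cvg_cmul; [exact: cvg_cst | exact: cvg_id]. Qed.

Lemma continuous_cmulr a : continuous (fun x => x ** a).
Proof. by move=> x; apply: cvg_cmul; [exact: cvg_id | exact: cvg_cst]. Qed.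

Lemma continuous_cstar : continuous (@cstar R A).
Proof. by move=> x; apply: cvg_cstar; exact: cvg_id. Qed.

End CStarBasics.

(** * Square roots and positivity *)

Lemma geometric_lt (R : realType) (r e : R[i]) :
  0 <= r -> r < 1 -> 0 < e -> exists N, r ^+ N < e.
Proof.
move=> r0 r1 e0; have rR := RRe_real (ger0_real r0).
have eR := RRe_real (ger0_real (ltW e0)).
move: r0 r1 e0; rewrite -rR -eR (_ : 1 = (1%:C)%C) // (_ : 0 = (0%:C)%C) // !ltcR lecR.
move=> r0 r1 e0.
have /cvg_expr/cvgrPdist_lt/(_ _ e0) : `|complex.Re r| < 1 by rewrite ger0_norm.
case=> N _ /(_ N (leqnn N)) /=; rewrite sub0r normrN normrX (ger0_norm r0) => h.
by exists N; rewrite -rmorphXn ltcR.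
Qed.

Section SquareRoot.
Variables (R : realType) (A : cstarAlgType R).
Implicit Types (x y z a b : A).

(** A square root of the unit minus [a], written without a unit: the equation
    says (1 - c)^2 = 1 - a.  It is the fixed point of x |-> (a + x^2)/2, a
    contraction of the ball of radius |a|.  Being a limit of iterates, [c]
    lies in every closed set that they cannot leave, and so inherits from [a]
    self-adjointness and commutation relations. *)
Lemma one_minus_sqrt a : `|a| < 1 ->
  exists c, c + c - c ** c = a /\
    forall S : set A, closed S -> S 0 ->
      (forall x, S x -> S (2^-1 *: (a + x ** x))) -> S c.
Proof.
move=> a1; set r := `|a| in a1 *.
have r0 : 0 <= r by exact: normr_ge0.
pose G x := 2^-1 *: (a + x ** x).
pose u n := iter n G 0.
have two : 0 < 2^-1 :> R[i] by rewrite invr_gt0 ltr0n.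
have Gball x : `|x| <= r -> `|G x| <= r.
  move=> xr; rewrite normrZ gtr0_norm // -(ler_pM2l (ltr0Sn R[i] 1)).
  rewrite mulrA divff ?pnatr_eq0 // mul1r mulr_natl mulr2n.
  apply: (le_trans (ler_normD _ _)); rewrite lerD //.
  apply: (le_trans (cnormM _ _)); rewrite -[leRHS]mulr1.
  by apply: ler_pM => //; apply: le_trans xr (ltW a1).
have Gcontr x y : `|x| <= r -> `|y| <= r -> `|G x - G y| <= r * `|x - y|.
  move=> xr yr; rewrite /G -scalerBr normrZ gtr0_norm //.
  rewrite -(ler_pM2l (ltr0Sn R[i] 1)) mulrA divff ?pnatr_eq0 // mul1r.
  rewrite opprD addrACA subrr add0r.
  have -> : x ** x - y ** y = x ** (x - y) + (x - y) ** y.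
    by rewrite cmulBr cmulBl addrA subrK.
  rewrite mulr_natl mulr2n; apply: (le_trans (ler_normD _ _)).
  rewrite lerD // (le_trans (cnormM _ _)) //; first exact: ler_wpM2r.
  by rewrite mulrC ler_wpM2r.
have ur n : `|u n| <= r.
  by elim: n => [|n IH]; [rewrite normr0 | exact: Gball].
have udist n m : `|u n - u (n + m)%N| <= r ^+ n.
  elim: n => [|n IH].
    by rewrite sub0r normrN expr0; apply: le_trans (ur m) (ltW a1).
  rewrite addSn; apply: (le_trans (Gcontr _ _ (ur n) (ur _))).
  by rewrite exprS; exact: ler_wpM2l.
have ucvg : cvg (u @ \oo).
  apply: cauchy_cvg; apply: cauchy_exP => e e0.
  have [N rN] := geometric_lt r0 a1 e0.
  exists (u N); exists N => // n /= Nn; rewrite -ball_normE /=.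
  by rewrite -(subnKC Nn); apply: le_lt_trans (udist _ _) rN.
have Gc : continuous G.
  move=> x; apply: cvgZr; apply: cvgD; first exact: cvg_cst.
  by apply: cvg_cmul; exact: cvg_id.
have fixed : G (lim (u @ \oo)) = lim (u @ \oo).
  have shift : u n.+1 @[n --> \oo] --> lim (u @ \oo) by rewrite cvg_shiftS.
  apply: (cvg_unique (@norm_hausdorff _ A) _ shift).
  exact: (cvg_comp _ _ ucvg (Gc _)).
exists (lim (u @ \oo)); split.
  rewrite -[X in X + X](_ : G (lim (u @ \oo)) = _) // /G -scalerDl.
  by rewrite -div1r -splitr scale1r addrK.
move=> S Scl S0 SG; apply: (closed_cvg S Scl _ _ ucvg).
by apply: nearW => n; elim: n => [|n IH] //=; exact: SG.
Qed.


Lemma one_minus_sqrt_sa a : a^# = a -> `|a| < 1 ->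
  exists c, [/\ c + c - c ** c = a, c^# = c,
    forall b, a ** b = b ** a -> c ** b = b ** c
    & forall e, e ** a = a -> e ** c = c].
Proof.
move=> sa /one_minus_sqrt[c [ca cS]]; exists c; split => //.
- apply: (cS [set x | x^# = x]) => [||x /= xx].
  + by apply: closed_coincidence; [exact: continuous_cstar | move=> x; exact: cvg_id].
  + exact: cstar0.
  + by rewrite cstarZ fmorphV rmorph_nat cstarD cstarM sa xx.
- move=> b ab; apply: (cS [set x | x ** b = b ** x]) => [||x /= xb].
  + by apply: closed_coincidence; [exact: continuous_cmulr | exact: continuous_cmull].
  + by rewrite /= cmul0x cmulx0.
  + by rewrite cmulZl cmulZr cmulDl cmulDr ab -cmulA xb !cmulA xb.
- move=> e ea; apply: (cS [set x | e ** x = x]) => [||x /= ex].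
  + by apply: closed_coincidence; [exact: continuous_cmull | move=> x; exact: cvg_id].
  + exact: cmulx0.
  + by rewrite cmulZr cmulDr ea cmulA ex.
Qed.

(** When [x^# ** y] is self-adjoint, both x + iy and x - iy have square
    x^# x + y^# y, and [x] is their mean. *)
Lemma norm_pythagoras (x y : A) : x^# ** y = y^# ** x ->
  `|x| ^+ 2 <= `|x^# ** x + y^# ** y|.
Proof.
move=> xy.
have sq (w : R[i]) : w^* = - w -> w * w = -1 ->
    `|x + w *: y| ^+ 2 = `|x^# ** x + y^# ** y|.
  move=> wc ww; rewrite -cnorm_star; congr (`|_|).
  rewrite cstarD cstarZ wc cmulDl !cmulDr !cmulZl !cmulZr xy scalerA mulNr ww.
  by rewrite opprK scale1r scaleNr addrA addrK.
have e1 := sq 'i (conjCi _) (mulCii _).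
have e2 : `|x - 'i *: y| ^+ 2 = `|x^# ** x + y^# ** y|.
  rewrite -scaleNr; apply: sq; first by rewrite rmorphN; congr (- _); exact: conjCi.
  by rewrite mulrNN mulCii.
have e12 : `|x - 'i *: y| = `|x + 'i *: y|.
  by apply/eqP; rewrite -(@eqrXn2 _ 2) ?normr_ge0 // e1 e2.
rewrite -e1 ler_pXn2r ?nnegrE ?normr_ge0 //.
rewrite -(ler_pM2l (ltr0Sn R[i] 1)) [leRHS]mulr_natl [leRHS]mulr2n -{2}e12.
apply: le_trans (ler_normD _ _); rewrite addrACA subrr addr0 -mulr2n.
by rewrite normrMn mulr_natl.
Qed.

(** For small d > 0, both d e + h and d e - h are, up to a scalar, squares of
    commuting self-adjoint elements of the corner of [e].  The squares add up
    to 2d e, so each has norm at most 2d, which bounds |h| by 3d.  Thus the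
    unit of the corner is an extreme point of its unit ball, in self-adjoint
    directions. *)
Lemma unit_extreme (e h : A) : is_projection e -> h^# = h -> e ** h = h ->
  `|e + h| <= 1 -> `|e - h| <= 1 -> h = 0.
Proof.
move=> [es ee] hs eh n1 n2; have he : h ** e = h by rewrite -hs -{1}es -cstarM eh.
apply/eqP; rewrite -normr_eq0; apply: contraT => hn0.
have hgt : 0 < `|h| by rewrite lt_def hn0 normr_ge0.
pose d : R[i] := `|h| / 4%:R; have d0 : 0 < d by rewrite divr_gt0 // ltr0n.
have d1 : 0 < 1 + d by rewrite addr_gt0.
have d1n : 1 + d != 0 by rewrite gt_eqF.
have dlt : (1 + d)^-1 < 1 by rewrite invf_lt1 // ltrDl.
pose a (g : A) := (1 + d)^-1 *: (e - g).
have root g : g^# = g -> e ** g = g -> `|e - g| <= 1 -> exists c,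
    [/\ c + c - c ** c = a g, c^# = c, e ** c = c, c ** e = c &
        forall b, a g ** b = b ** a g -> c ** b = b ** c].
  move=> gs eg gn; have sa : (a g)^# = a g.
    rewrite cstarZ cstarB es gs; congr (_ *: _).
    by rewrite geC0_conj // invr_ge0 ltW.
  have an : `|a g| < 1.
    rewrite normrZ gtr0_norm ?invr_gt0 //; apply: le_lt_trans dlt.
    by rewrite -[leRHS]mulr1 ler_pM2l // invr_gt0.
  have [c [ca cs cb ce]] := one_minus_sqrt_sa sa an.
  have ec : e ** c = c by apply: ce; rewrite cmulZr cmulBr ee eg.
  by exists c; split => //; rewrite -cs -{1}es -cstarM ec.
have [c [ca cs ec ce cc]] := root h hs eh n2.
have [c' [ca' cs' ec' ce' cc']] : exists c,
    [/\ c + c - c ** c = a (- h), c^# = c, e ** c = c, c ** e = c &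
        forall b, a (- h) ** b = b ** a (- h) -> c ** b = b ** c].
  by apply: root; rewrite ?cstarN ?hs ?cmulxN ?eh // opprK.
have aN : a (- h) = (2 / (1 + d)) *: e - a h.
  rewrite /a opprK [2 / _]mulrC -scalerA -scalerBr; congr (_ *: _).
  by rewrite scaler_nat mulr2n opprB addrACA subrr addr0.
have com : c ** c' = c' ** c.
  apply/esym/cc'; rewrite aN cmulBl cmulBr cmulZl cmulZr ec ce.
  by rewrite -cc.
have sq g k : k^# = k -> e ** k = k -> k ** e = k -> k + k - k ** k = g ->
    (e - k)^# ** (e - k) = e - g.
  move=> ks ek ke <-; rewrite cstarB es ks cmulBl !cmulBr ee ek ke.
  by rewrite !opprB opprD !addrA [in RHS]addrAC.
have Y := sq _ _ cs ec ce ca; have Z := sq _ _ cs' ec' ce' ca'.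
have nyz : `|e - c| ^+ 2 <= 2 * d / (1 + d).
  have : (e - c)^# ** (e - c') = (e - c')^# ** (e - c).
    rewrite !cstarB es cs cs' !cmulBl !cmulBr ee ec ce ec' ce' com !opprB !addrA.
    by rewrite addrAC [RHS]addrAC; congr (_ + _); rewrite addrAC.
  move=> /norm_pythagoras/le_trans; apply; rewrite Y Z aN opprB addrACA addKr -addrA.
  have -> : e + (e - (2 / (1 + d)) *: e) = (2 * d / (1 + d)) *: e.
    rewrite -{1 2}[e]scale1r -scalerBl -scalerDl; congr (_ *: _).
    by field.
  rewrite normrZ -[leRHS]mulr1 ger0_norm ?divr_ge0 ?mulr_ge0 ?(ltW d0, ltW d1) //.
  by rewrite ler_wpM2l ?projection_norm // divr_ge0 ?mulr_ge0 ?(ltW d0, ltW d1).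
have eah : e - a h = (1 + d)^-1 *: (d *: e + h).
  rewrite -{1}[e](scalerK d1n) -scalerBr scalerDl scale1r opprB [e + _]addrC.
  by rewrite addrACA subrr addr0.
have : `|d *: e + h| <= 2 * d.
  have i0 : 0 < (1 + d)^-1 by rewrite invr_gt0.
  rewrite -(ler_pM2l i0) [leRHS]mulrC -{1}(gtr0_norm i0) -normrZ -eah -Y.
  by rewrite cnorm_star.
move=> dh; have : `|h| <= 2 * d + d.
  rewrite -{1}[h](addKr (d *: e)) addrC; apply: (le_trans (ler_normB _ _)).
  rewrite lerD // normrZ (gtr0_norm d0) -[leRHS]mulr1 ler_pM2l //.
  exact: projection_norm.
have -> : 2 * d + d = `|h| * (3%:R / 4%:R) by rewrite /d; field.
by rewrite -[leLHS]mulr1 ler_pM2l // ler_pdivlMr ?ltr0n // mul1r ler_nat.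
Qed.

(** Put f = e j and let [h] be the sum of the compressions f (e i) f of the
    other projections.  Then f + h = f p f lies in the unit ball, and so does
    every f - f (e i) f.  After division by the number of terms, f + h and
    f - h both stay in the unit ball, and [unit_extreme] gives h = 0.  So
    f p f = f, which says that [p] fixes [f]. *)
Lemma projection_summand (I : eqType) (r : seq I) (e : I -> A) (p : A) j :
  (forall i, i \in r -> is_projection (e i)) -> is_projection p ->
  p = \sum_(i <- r) e i -> j \in r -> p ** e j = e j.
Proof.
move=> eproj pproj pE jr; have [fs ff] := eproj j jr; set f := e j in fs ff *.
have compress g : is_projection g -> `|f - f ** g ** f| <= 1.
  move=> [gs gg].
  have sqf : (g ** f)^# ** (g ** f) = f ** g ** f.
    by rewrite cstarM gs fs -cmulA [g ** (g ** f)]cmulA gg cmulA.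
  have sqc : (f - g ** f)^# ** (f - g ** f) = f - f ** g ** f.
    rewrite cstarB cstarM gs fs cmulBl !cmulBr ff -[f ** g ** (g ** f)]cmulA.
    by rewrite [g ** (g ** f)]cmulA gg [f ** (g ** f)]cmulA subrr subr0.
  rewrite -sqc cnorm_star.
  have : (f - g ** f)^# ** (g ** f) = (g ** f)^# ** (f - g ** f).
    rewrite cstarB !cstarM gs fs cmulBl cmulBr.
    rewrite -[f ** g ** (g ** f)]cmulA [g ** (g ** f)]cmulA gg subrr.
    by rewrite cmulA subrr.
  move=> /norm_pythagoras/le_trans; apply.
  by rewrite sqc sqf subrK; apply: projection_norm.
pose r' := rem j r; pose n := (size r').+1.
pose h := \sum_(i <- r') f ** e i ** f.
have pf : f ** p ** f = f + h.
  by rewrite pE (perm_big _ (perm_to_rem jr)) big_cons cmulDr cmulDl ff ff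
    cmul_sumr cmul_suml.
have fh1 : `|f + h| <= 1.
  rewrite -pf; apply: (le_trans (cnormM _ _)); rewrite -[leRHS]mulr1.
  apply: ler_pM => //; last exact: projection_norm.
  apply: (le_trans (cnormM _ _)); rewrite -[leRHS]mulr1.
  by apply: ler_pM => //; exact: projection_norm.
have fn1 : `|f| <= 1 by exact: projection_norm.
have ns : `|f *+ n - h| <= n%:R.
  rewrite /n /h mulrSr addrAC -[X in _ <= X]natr1.
  apply: (le_trans (ler_normD _ _)); rewrite lerD //.
  have -> : f *+ size r' = \sum_(i <- r') f.
    by rewrite big_const_seq count_predT iter_addr addr0.
  rewrite -sumrB; apply: (le_trans (ler_norm_sum _ _ _)).
  have -> : (size r')%:R = \sum_(i <- r') (1 : R[i]).
    by rewrite big_const_seq count_predT iter_addr addr0.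
  rewrite !big_seq; apply: ler_sum => i ir.
  by apply: compress; apply: eproj; exact: mem_rem ir.
have nd : `|f *+ n + h| <= n%:R.
  rewrite /n mulrSr -addrA -[X in _ <= X]natr1.
  apply: (le_trans (ler_normD _ _)); rewrite lerD // normrMn.
  by rewrite lerMn2r fn1 orbT.
have n0 : n%:R != 0 :> R[i] by rewrite pnatr_eq0.
have h0 : h = 0.
  have np : 0 < n%:R :> R[i] by rewrite ltr0n.
  have sc x : `|f *+ n + x| <= n%:R -> `|f + n%:R^-1 *: x| <= 1.
    rewrite -{2}[f](scalerK n0) scaler_nat -scalerDr normrZ gtr0_norm ?invr_gt0 //.
    by rewrite ler_pdivrMl ?mulr1.
  have : n%:R^-1 *: h = 0.
    apply: (@unit_extreme f) => //.
    - rewrite cstarZ fmorphV rmorph_nat; congr (_ *: _).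
      rewrite /h cstar_sum [LHS]big_seq [RHS]big_seq.
      apply: eq_bigr => i /mem_rem/eproj[es _].
      by rewrite !cstarM fs es cmulA.
    - rewrite cmulZr cmul_sumr; congr (_ *: _); apply: eq_bigr => i _.
      by rewrite !cmulA ff.
    - exact: sc.
    - by rewrite -scalerN; exact: sc.
  by move=> /(congr1 ( *:%R n%:R)); rewrite scalerA divff // scale1r scaler0.
have [ps pp] := pproj.
apply/eqP; rewrite -subr_eq0; apply/eqP/cstar_mul_eq0.
rewrite cstarB cstarM ps fs cmulBl !cmulBr ff -[f ** p ** (p ** f)]cmulA.
by rewrite [p ** (p ** f)]cmulA pp [f ** (p ** f)]cmulA pf h0 addr0 !subrr.
Qed.

End SquareRoot.

Section StarHom.
Variables (R : realType) (A B : cstarAlgType R).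
Implicit Types (f g : A -> B).

Lemma star_hom0 f : star_hom f -> f 0 = 0.
Proof. by case=> _ fZ _ _; rewrite -(scale0r (0 : A)) fZ scale0r. Qed.

Lemma star_homB f : star_hom f -> forall x y, f (x - y) = f x - f y.
Proof. by case=> fD fZ _ _ x y; rewrite fD -scaleN1r fZ scaleN1r. Qed.

Lemma star_hom_sum f : star_hom f ->
  forall I (r : seq I) (P : pred I) (F : I -> A),
    f (\sum_(i <- r | P i) F i) = \sum_(i <- r | P i) f (F i).
Proof.
by move=> hf I r P F; apply: big_morph; [case: hf | exact: star_hom0].
Qed.

(** Automatic continuity.  For self-adjoint [a] of norm less than one, the
    identity a^2 + (1 - c)^2 = 1 is preserved by [f], and it says that
    f(a) + i(1 - f(c)) is unitary, so that its real part [f a] is a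
    contraction. *)
Lemma star_hom_norm f : star_hom f -> forall x, `|f x| <= `|x|.
Proof.
move=> hf x; have [fD fZ fM fS] := hf.
have small a : a^# = a -> `|a| < 1 -> `|f a| <= 1.
  move=> sa a1; have sa2 : (a ** a)^# = a ** a by rewrite cstarM sa.
  have a21 : `|a ** a| < 1.
    by apply: (le_lt_trans (cnormM _ _)); rewrite -expr2 expr_lt1.
  have [c [ca cs cb _]] := one_minus_sqrt_sa sa2 a21.
  set b := f a; set d := f c.
  have bs : b^# = b by rewrite -fS sa.
  have ds : d^# = d by rewrite -fS cs.
  have bd : b ** d = d ** b by rewrite -!fM cb // cmulA.
  have bb : d + d - d ** d = b ** b by rewrite -!fM -!fD -star_homB // ca.
  have contr z : `|b ** z| <= `|z|.
    rewrite -(@ler_pXn2r _ 2) ?nnegrE ?normr_ge0 // -[leRHS]cnorm_star.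
    have : (b ** z)^# ** (z - d ** z) = (z - d ** z)^# ** (b ** z).
      rewrite cstarB !cstarM bs ds cmulBl cmulBr -!cmulA.
      by rewrite [b ** (d ** z)]cmulA bd -cmulA.
    move=> /norm_pythagoras/le_trans; apply.
    rewrite cstarB !cstarM bs ds cmulBl !cmulBr -!cmulA [b ** (b ** z)]cmulA -bb.
    rewrite !cmulBl !cmulDl !cmulBr !cmulDr !cmulA.
    set u := z^# ** d ** z; set v := z^# ** d ** d ** z.
    by rewrite opprB addrACA addKr [u + u + _]addrC addrA subrK addrK.
  have [->|b0] := eqVneq b 0; first by rewrite normr0 ler01.
  have bn : 0 < `|b| by rewrite normr_gt0.
  by rewrite -(ler_pM2r bn) -expr2 -cnorm_star bs mul1r; exact: contr.
have rx : `|x| \is Num.real by exact: normr_real.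
have rfx : `|f x| \is Num.real by exact: normr_real.
case: (real_leP rfx rx) => // lt; exfalso.
(* The bound for norms below one is not strict, so x is rescaled by a number
   strictly between |x| and |f x|. *)
pose m := (`|x| + `|f x|) / 2.
have half : 0 < 2^-1 :> R[i] by rewrite invr_gt0 ltr0n.
have xm : `|x| < m.
  by rewrite [ltLHS]splitr /m mulrDl ltrD2l ltr_pM2r.
have mfx : m < `|f x|.
  by rewrite [ltRHS]splitr /m mulrDl ltrD2r ltr_pM2r.
have m0 : 0 < m by apply: le_lt_trans xm.
have m2 : 0 < m ^+ 2 by rewrite exprn_gt0.
have := small ((m ^+ 2)^-1 *: (x^# ** x)).
rewrite cstarZ cstarM cstarK geC0_conj; last by rewrite invr_ge0 ltW.
move=> /(_ erefl).
rewrite normrZ fZ fM fS normrZ !cnorm_star gtr0_norm ?invr_gt0 //.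
rewrite ltr_pdivrMl // ler_pdivrMl // !mulr1.
rewrite ltr_pXn2r ?nnegrE ?normr_ge0 ?(ltW m0) // => /(_ xm).
rewrite ler_pXn2r ?nnegrE ?normr_ge0 ?(ltW m0) // => /le_lt_trans/(_ mfx).
by rewrite ltxx.
Qed.

Lemma star_hom_continuous f : star_hom f -> continuous f.
Proof.
move=> hf; apply: (@continuous_bound _ _ _ _ 1) => x y.
by rewrite mul1r -star_homB //; exact: star_hom_norm.
Qed.

Lemma star_hom_eq (G : set A) f g : generated_by G ->
  star_hom f -> star_hom g -> (forall x, G x -> f x = g x) -> f =1 g.
Proof.
move=> gen hf hg fg; have [fD fZ fM fS] := hf; have [gD gZ gM gS] := hg.
suff S : [set x | f x = g x] = setT.
  by move=> x; have : [set x | f x = g x] x by rewrite S.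
apply: gen => //; split.
- by apply: closed_coincidence; exact: star_hom_continuous.
- by rewrite /= !star_hom0.
- by move=> x y /= ex ey; rewrite fD gD ex ey.
- by move=> c x /= ex; rewrite fZ gZ ex.
- by split=> [x y|x] /= ex; [move=> ey; rewrite fM gM ex ey | rewrite fS gS ex].
Qed.

End StarHom.

Lemma star_hom_id (R : realType) (A : cstarAlgType R) : star_hom (@id A).
Proof. by []. Qed.

Lemma star_hom_comp (R : realType) (A B C : cstarAlgType R) (f : A -> B)
    (g : B -> C) : star_hom f -> star_hom g -> star_hom (g \o f).
Proof.
case=> fD fZ fM fS [gD gZ gM gS]; split=> /= *.
- by rewrite fD gD.
- by rewrite fZ gZ.
- by rewrite fM gM.
- by rewrite fS gS.
Qed.

(** * Multipliers *)

Section ContractionLimits.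
Variables (K : numFieldType) (V : normedModType K).

(** This and [closed_is_cvg] reduce convergence on a C*-algebra to convergence
    on generators: limits of uniformly Lipschitz maps pass to the closure. *)
Lemma closed_cvg_to (W : normedModType K) (T : nat -> V -> W) (S : V -> W) :
  (forall n x y, `|T n x - T n y| <= `|x - y|) ->
  (forall x y, `|S x - S y| <= `|x - y|) ->
  closed [set x | T n x @[n --> \oo] --> S x].
Proof.
move=> Tc Sc x clx /=; apply/cvgrPdist_lt => e e0.
have e4 : 0 < e / 2 / 2 by rewrite !divr_gt0.
have /cvgrPdist_lt/(_ _ e4) nx := @cvg_id _ (nbhs x).
have [y [/= Ty xy]] := clx _ nx.
have /cvgrPdist_lt/(_ _ e4) := Ty; apply: filterS => n ny.
have ye : `|x - y| < e / 2.
  by apply: lt_trans xy _; rewrite gtr_pMr ?invf_lt1 ?ltr1n // divr_gt0.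
rewrite (splitr e); apply: (le_lt_trans (ler_distD (S y) _ _)).
apply: ltrD; first by apply: le_lt_trans ye.
rewrite (splitr (e / 2)); apply: (le_lt_trans (ler_distD (T n y) _ _)).
by rewrite ltrD //; apply: (le_lt_trans (Tc _ _ _)); rewrite distrC.
Qed.

Lemma closed_is_cvg (W : completeNormedModType K) (T : nat -> V -> W) :
  (forall n x y, `|T n x - T n y| <= `|x - y|) ->
  closed [set x | cvg (T n x @[n --> \oo])].
Proof.
move=> Tc x clx /=; apply: cauchy_cvg; apply: cauchy_exP => e e0.
have e2 : 0 < e / 2 by rewrite divr_gt0.
have /cvgrPdist_lt/(_ _ e2) nx := @cvg_id _ (nbhs x).
have [y [/= Ty xy]] := clx _ nx.
exists (lim (T n y @[n --> \oo])).
have /cvgrPdist_lt/(_ _ e2) := Ty; apply: filterS => n ny.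
rewrite -ball_normE /= (splitr e).
apply: (le_lt_trans (ler_distD (T n y) _ _)); rewrite ltrD //.
by apply: (le_lt_trans (Tc _ _ _)); rewrite distrC.
Qed.

End ContractionLimits.

Section MultiplierTheory.
Variables (R : realType) (A : cstarAlgType R).
Implicit Types (x y z a b : A) (T U V : multiplier A).

Lemma cmul_faithfulr x y : (forall z, z ** x = z ** y) -> x = y.
Proof.
move=> e; apply: (can_inj cstarK); apply: cmul_faithful => z.
by apply: (can_inj cstarK); rewrite !cstarM !cstarK.
Qed.

(** Since [x ** mleft T y = mright T x ** y], either half of a double
    centralizer determines the other. *)
Lemma mult_ext T U : mleft T =1 mleft U -> T = U.
Proof.
case: T U => [lT rT pT] [lU rU pU] /= e.
have el : lT = lU by apply/funext.
have er : rT = rU.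
  apply/funext => x; apply: cmul_faithful => y.
  by rewrite -pT -pU e.
case: _ / el er pU {e} => er; case: _ / er => pU.
by congr Multiplier; exact: Prop_irrelevance.
Qed.

Lemma mleftM T x y : mleft T (x ** y) = mleft T x ** y.
Proof.
by apply: cmul_faithfulr => z; rewrite multiplierP !cmulA multiplierP.
Qed.

Lemma mrightM T x y : mright T (x ** y) = x ** mright T y.
Proof.
by apply: cmul_faithful => z; rewrite -multiplierP -!cmulA multiplierP.
Qed.

Lemma mleftD T x y : mleft T (x + y) = mleft T x + mleft T y.
Proof.
by apply: cmul_faithfulr => z; rewrite multiplierP !cmulDr !multiplierP.
Qed.

Lemma mleftZ T c x : mleft T (c *: x) = c *: mleft T x.
Proof.
by apply: cmul_faithfulr => z; rewrite multiplierP !cmulZr multiplierP.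
Qed.

Lemma mrightD T x y : mright T (x + y) = mright T x + mright T y.
Proof.
by apply: cmul_faithful => z; rewrite -multiplierP !cmulDl !multiplierP.
Qed.

Lemma mrightZ T c x : mright T (c *: x) = c *: mright T x.
Proof.
by apply: cmul_faithful => z; rewrite -multiplierP !cmulZl multiplierP.
Qed.

Lemma mrightB T x y : mright T (x - y) = mright T x - mright T y.
Proof. by rewrite mrightD -scaleN1r mrightZ scaleN1r. Qed.

Lemma mright_sum T I (r : seq I) (P : pred I) (F : I -> A) :
  mright T (\sum_(i <- r | P i) F i) = \sum_(i <- r | P i) mright T (F i).
Proof.
apply: (big_morph (mright T)); first exact: mrightD.
by rewrite -(scale0r (0 : A)) mrightZ !scale0r.
Qed.

Lemma mleft_mright T U x : mleft T (mright U x) = mright U (mleft T x).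
Proof.
apply: cmul_faithfulr => z.
by rewrite multiplierP -!mrightM multiplierP.
Qed.

Lemma mult_of_inj : injective (@mult_of R A).
Proof.
move=> x y e; apply: cmul_faithful => z.
exact: (congr1 (fun T => mleft T z) e).
Qed.

(** Conjugation by [U] on the algebra itself rather than on its multipliers, so
    that it can be compared with other *-homomorphisms on generators. *)
Definition mult_Ad U x := mright (mult_star U) (mleft U x).

Lemma mult_conj_of U x : mult_conj U (mult_of x) = mult_of (mult_Ad U x).
Proof.
apply: mult_ext => z.
rewrite /mult_conj /mult_mul [LHS]/= [RHS]/= /mult_Ad mleftM.
exact: (multiplierP (mult_star U) (mleft U x) z).
Qed.

Section Unitary.
Variables (U : multiplier A) (hU : mult_unitary U).

Lemma mleft_unitaryK : cancel (mleft U) (mleft (mult_star U)).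
Proof. by move=> x; exact: (congr1 (fun T => mleft T x) hU.1). Qed.

Lemma mright_unitaryK : cancel (mright U) (mright (mult_star U)).
Proof. by move=> x; exact: (congr1 (fun T => mright T x) hU.2). Qed.

Lemma mright_unitaryVK : cancel (mright (mult_star U)) (mright U).
Proof. by move=> x; exact: (congr1 (fun T => mright T x) hU.1). Qed.

Lemma mright_unitary_star x : mright U x ** (mright U x)^# = x ** x^#.
Proof.
have -> : (mright U x)^# = mleft (mult_star U) x^# by rewrite /= cstarK.
by rewrite (multiplierP (mult_star U)) mright_unitaryK.
Qed.

Lemma mright_unitary_norm x : `|mright U x| = `|x|.
Proof.
rewrite -normc_star -[RHS]normc_star; apply: norm_eq_star_mul.
by rewrite !cstarK mright_unitary_star.
Qed.

Lemma mright_unitary_continuous : continuous (mright U).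
Proof.
apply: (@continuous_bound _ _ _ _ 1) => x y.
by rewrite mul1r -mrightB mright_unitary_norm.
Qed.

(** To compute a conjugate it suffices to guess it: U x = y U involves no
    adjoint, and both sides are limits of partial sums. *)
Lemma mult_Ad_intertwine x y : mleft U x = mright U y -> mult_Ad U x = y.
Proof. by rewrite /mult_Ad => ->; rewrite mright_unitaryK. Qed.

Lemma mult_Ad_star_hom : star_hom (mult_Ad U).
Proof.
split=> [x y|c x|x y|x].
- by rewrite /mult_Ad mleftD mrightD.
- by rewrite /mult_Ad mleftZ mrightZ.
- rewrite /mult_Ad -mrightM; congr mright.
  by rewrite -(multiplierP (mult_star U)) mleft_unitaryK mleftM.
- by rewrite /mult_Ad -mleft_mright /= !cstarK.
Qed.

End Unitary.

(** The pointwise limits on the two sides are related by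
    x (lim u_n y) = (lim x u_n) y, which is the double centralizer condition. *)
Lemma strict_limit (u : nat -> A) :
  (forall a, cvg (u n ** a @[n --> \oo])) ->
  (forall a, cvg (a ** u n @[n --> \oo])) ->
  exists U, strict_cvg (fun n => mult_of (u n)) U.
Proof.
move=> cl cr.
pose l a := lim (u n ** a @[n --> \oo]); pose r a := lim (a ** u n @[n --> \oo]).
have lr x y : x ** l y = r x ** y.
  have h1 : (x ** (u n ** y)) @[n --> \oo] --> x ** l y.
    by apply: cvg_cmul; [exact: cvg_cst | exact: cl].
  have h2 : (x ** (u n ** y)) @[n --> \oo] --> r x ** y.
    under eq_fun do rewrite cmulA.
    by apply: cvg_cmul; [exact: cr | exact: cvg_cst].
  exact: (cvg_unique (@norm_hausdorff _ A) h1 h2).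
by exists (Multiplier lr) => a; split; [exact: cl | exact: cr].
Qed.

Lemma strict_cvg_star (u : nat -> A) U a :
  strict_cvg (fun n => mult_of (u n)) U ->
  (u n)^# ** a @[n --> \oo] --> mleft (mult_star U) a.
Proof.
move=> hU.
have -> : (fun n => (u n)^# ** a) = (fun n => (a^# ** u n)^#).
  by apply/funext => n; rewrite cstarM cstarK.
exact: (cvg_cstar (hU a^#).2).
Qed.

(** Multiplication is jointly strictly continuous on bounded sequences, so the
    limits of u_n^* u_n and u_n u_n^* are the products of the limits. *)
Lemma strict_limit_unitary (u : nat -> A) U :
  (forall n, `|u n| <= 1) -> strict_cvg (fun n => mult_of (u n)) U ->
  (forall a, (u n)^# ** u n ** a @[n --> \oo] --> a) ->
  (forall a, u n ** (u n)^# ** a @[n --> \oo] --> a) ->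
  mult_unitary U.
Proof.
have aux (f g : nat -> A) a b : (forall n, `|f n| <= 1) ->
    g n ** a @[n --> \oo] --> b -> f n ** g n ** a @[n --> \oo] --> a ->
    f n ** b @[n --> \oo] --> a.
  move=> f1 gb fg.
  have z : f n ** (b - g n ** a) @[n --> \oo] --> (0 : A).
    apply: (@cvg_dominated _ _ _ _ _ _ _ (fun n => `|b - g n ** a|)) => [n|].
      rewrite sub0r normrN; apply: (le_trans (cnormM _ _)).
      by rewrite -[leRHS]mul1r; exact: ler_wpM2r.
    exact: cvg_dist0.
  have -> : (fun n => f n ** b) =
      (fun n => f n ** (b - g n ** a) + f n ** g n ** a).
    by apply/funext => n; rewrite cmulBr cmulA subrK.
  by rewrite -[X in _ --> X]add0r; exact: cvgD.
move=> u1 hU h1 h2; split; apply: mult_ext => a /=.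
- have us n : `|(u n)^#| <= 1 by rewrite normc_star.
  have h := aux (fun n => (u n)^#) u a _ us (hU a).1 (h1 a).
  exact: (cvg_unique (@norm_hausdorff _ A) (strict_cvg_star hU) h).
- have h := aux u (fun n => (u n)^#) a _ u1 (strict_cvg_star hU) (h2 a).
  exact: (cvg_unique (@norm_hausdorff _ A) (hU _).1 h).
Qed.

End MultiplierTheory.

(** * Twisted Cuntz-Krieger families *)

Section KGraphBasics.
Variables (k : nat) (L : kgraph k).
Implicit Types (x : L).

(** A path of degree 0 factors both as itself followed by an identity and as
    an identity followed by itself. *)
Lemma kdeg_eq0 x : kdeg x = 0 -> x = kid L (krng x).
Proof.
move=> d0; have e : kdeg x = 0 + 0 by rewrite addr0.
have [yz [_ uniq_yz]] := kfactor e.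
have h1 : yz = (kid L (krng x), x).
  by apply: uniq_yz; split; rewrite //= ?kdeg_id ?ksrc_id ?kcompose_idl.
have h2 : yz = (x, kid L (ksrc x)).
  by apply: uniq_yz; split; rewrite //= ?kdeg_id ?krng_id ?kcompose_idr.
by move: h1; rewrite h2 => -[].
Qed.

Lemma cubes1P x : cubes 1 x <-> exists i, kdeg x = unitdeg i.
Proof.
split=> [[le1 s1]|[i e]]; last first.
  split=> [j|]; first by rewrite e ffunE; case: eqP.
  rewrite (bigD1 i) //= big1 => [|j ji]; first by rewrite e ffunE eqxx.
  by rewrite e ffunE (negPf ji).
have [i di] : exists i, kdeg x i != 0%N.
  apply/existsP; apply: contraT; rewrite negb_exists => /forallP z.
  by move: s1; rewrite big1 // => i _; apply/eqP; move: (z i); rewrite negbK.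
exists i; apply/ffunP => j; rewrite ffunE; move: s1; rewrite (bigD1 i) //=.
have -> : kdeg x i = 1%N by have := le1 i; case: (kdeg x i) di => [|[]].
case: eqP => [-> _|ji]; first by have := le1 i; case: (kdeg x i) di => [|[]].
move=> [] /eqP; rewrite sum_nat_eq0 => /forallP/(_ j)/implyP.
by move=> h; apply/eqP/h/eqP.
Qed.

End KGraphBasics.

Lemma exhausting_in (T : choiceType) (F : nat -> {fset T}) v :
  exhausting F -> \forall n \near \oo, v \in F n.
Proof.
case=> mono /(_ v)[N vN]; exists N => // n /= Nn.
by have /fsubsetP := mono _ _ Nn; apply.
Qed.

Section TwistedFamilies.
Variables (R : realType) (k : nat) (L : kgraph k).
Variable hL : row_finite_no_sources L.
Variables (phi : L -> R[i]) (A : cstarAlgType R).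
Variables (p : kob L -> A) (s : L -> A).
Hypothesis ck : ck_rep phi p s.

Lemma ck_projection v : is_projection (p v).
Proof. by case: ck => -[pp _] _ _ _; exact: pp. Qed.

Lemma ck_mulpp v : p v ** p v = p v. Proof. by have [] := ck_projection v. Qed.

Lemma ck_starp v : (p v)^# = p v. Proof. by have [] := ck_projection v. Qed.

Lemma ck_orthogonal v w : v != w -> p v ** p w = 0.
Proof. by case: ck => -[_ po] _ _ _; exact: po. Qed.

Lemma ck_source x : cubes 1 x -> (s x)^# ** s x = p (ksrc x).
Proof. by case: ck => _ + _ _; exact. Qed.

Lemma ck_right_unit x : cubes 1 x -> s x ** p (ksrc x) = s x.
Proof.
move=> x1; apply/eqP; rewrite -subr_eq0; apply/eqP/cstar_mul_eq0.
rewrite cstarB cstarM ck_starp cmulBl !cmulBr !cmulA.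
rewrite -[_ ** _^# ** s x]cmulA ck_source // !ck_mulpp.
by rewrite !subrr.
Qed.

(** The range projections of the edges of one degree at [v] sum up to the
    projection [p v], and so lie below it by [projection_summand]. *)
Lemma ck_left_unit x : cubes 1 x -> p (krng x) ** s x = s x.
Proof.
move=> x1; have /cubes1P[i di] := x1.
case: ck => _ _ _ /(_ (krng x) i (ex_intro _ x (conj erefl di))).
have fin : finite_set (paths_from (krng x) (unitdeg i)).
  by have [] := hL (krng x) (unitdeg i).
rewrite fsbig_finite //= => pE.
have e : p (krng x) ** (s x ** (s x)^#) = s x ** (s x)^#.
  apply: (projection_summand (e := fun y => s y ** (s y)^#) _ _ pE).
  - move=> y; rewrite in_fset_set // inE => -[_ dy].
    have y1 : cubes 1 y by apply/cubes1P; exists i.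
    split; first by rewrite cstarM cstarK.
    by rewrite cmulA -[s y ** _ ** s y]cmulA ck_source // ck_right_unit.
  - exact: ck_projection.
  - by rewrite in_fset_set // inE.
rewrite -[in RHS](ck_right_unit x1) -ck_source // cmulA -e.
by rewrite -!cmulA ck_source // ck_right_unit.
Qed.

Lemma sum_unique_term (I : eqType) (r : seq I) (f : I -> A) v :
  uniq r -> (forall w, w != v -> f w = 0) ->
  \sum_(w <- r) f w = if v \in r then f v else 0.
Proof.
move=> ur f0; case: ifP => [vr|/negP vr].
  by rewrite (bigD1_seq v) //= big1 ?addr0 // => w; exact: f0.
rewrite big_seq big1 // => w wr; apply: f0; apply/eqP => wv.
by apply: vr; rewrite -wv.
Qed.

Lemma ck_sum_mul (D : {fset kob L}) v : v \in D -> (\sum_(w <- D) p w) ** p v = p v.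
Proof.
move=> vD; rewrite cmul_suml (@sum_unique_term _ _ _ v) ?vD ?ck_mulpp //.
by move=> w; exact: ck_orthogonal.
Qed.

Lemma ck_sum_projection (D : {fset kob L}) : is_projection (\sum_(v <- D) p v).
Proof.
split; first by rewrite cstar_sum; apply: eq_bigr => v _; exact: ck_starp.
by rewrite cmul_sumr big_seq [RHS]big_seq; apply: eq_bigr => v; exact: ck_sum_mul.
Qed.

Section ApproximateIdentity.
Variable F : nat -> {fset kob L}.
Hypothesis hF : exhausting F.
Hypothesis gen : generated_by (range p `|` s @` cubes 1).

(** Each generator is eventually fixed by the sums of vertex projections, and
    the elements on which these converge, together with their adjoints, form a
    closed *-subalgebra. *)
Lemma ck_approximate_identity a :
  (\sum_(v <- F n) p v) ** a @[n --> \oo] --> a.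
Proof.
pose P n := \sum_(v <- F n) p v.
have Pc n x y : `|P n ** x - P n ** y| <= `|x - y|.
  rewrite -cmulBr; apply: (le_trans (cnormM _ _)).
  by rewrite -[leRHS]mul1r ler_wpM2r // projection_norm //; exact: ck_sum_projection.
have fixed v x : p v ** x = x -> P n ** x @[n --> \oo] --> x.
  move=> vx; apply: cvg_near_cst.
  apply: filterS (exhausting_in v hF) => n vn.
  by rewrite -vx cmulA ck_sum_mul.
pose S := [set x | P n ** x @[n --> \oo] --> x] `&`
          [set x | P n ** x^# @[n --> \oo] --> x^#].
suff E : S = setT.
  by have [] : S a by rewrite E.
apply: gen; first split.
- apply: closedI.
    by apply: (@closed_cvg_to _ _ _ (fun n x => P n ** x) id).
  apply: (@closed_cvg_to _ _ _ (fun n x => P n ** x^#) cstar).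
    by move=> n x y; rewrite -[leRHS]normc_star cstarB.
  by move=> x y; rewrite -cstarB normc_star.
- by split; rewrite /= ?cstar0; under eq_fun do rewrite cmulx0; exact: cvg_cst.
- move=> x y [/= x1 x2] [/= y1 y2]; split; rewrite /= ?cstarD;
    by under eq_fun do rewrite cmulDr; exact: cvgD.
- move=> c x [/= x1 x2]; split; rewrite /= ?cstarZ;
    by under eq_fun do rewrite cmulZr; apply: cvgZr.
- split=> [x y [/= x1 x2] [/= y1 y2]|x [/= x1 x2]]; last by split; rewrite /= ?cstarK.
  by split; rewrite /= ?cstarM; under eq_fun do rewrite cmulA;
    apply: cvg_cmul => //; exact: cvg_cst.
- move=> x [[v _ <-]|[y y1 <-]]; split => /=.
  + by apply: (fixed v); rewrite ck_mulpp.
  + by rewrite ck_starp; apply: (fixed v); rewrite ck_mulpp.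
  + by apply: (fixed (krng y)); exact: ck_left_unit.
  + apply: (fixed (ksrc y)).
    by rewrite -[in LHS]ck_starp -cstarM ck_right_unit.
Qed.

Lemma ck_approximate_identityr a :
  a ** (\sum_(v <- F n) p v) @[n --> \oo] --> a.
Proof.
have -> : (fun n => a ** (\sum_(v <- F n) p v)) =
    (fun n => ((\sum_(v <- F n) p v) ** a^#)^#).
  apply/funext => n; rewrite cstarM cstarK.
  by have [-> _] := ck_sum_projection (F n).
by rewrite -[X in _ --> X]cstarK; apply: cvg_cstar; exact: ck_approximate_identity.
Qed.

End ApproximateIdentity.

End TwistedFamilies.

(** * Cubes of the crossed product graph *)

Section Faces.
Variables (k : nat) (L : kgraph k).
Implicit Types (x y z : L).

Lemma kdeg_factorization x y z :
  is_factorization x (y, z) -> kdeg x = kdeg y + kdeg z.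
Proof. by case=> /= yz <-; exact: kdeg_comp. Qed.

Lemma factorization_unique x y z y' z' :
  is_factorization x (y, z) -> is_factorization x (y', z') ->
  kdeg y = kdeg y' -> kdeg z = kdeg z' -> (y, z) = (y', z').
Proof.
move=> h h' ey ez; have [yz [_ u]] := kfactor (kdeg_factorization h).
case: h h' => /= c e [/= c' e'].
by rewrite -(u (y, z)) ?(u (y', z')) // -?ey -?ez.
Qed.

Lemma face0_eq i x y z : is_factorization x (y, z) -> kdeg z = unitdeg i ->
  face0 i x = y.
Proof.
move=> h dz; rewrite /face0; set P := (X in xget _ X).
rewrite (@xget_unique _ (x, x) P (y, z)) // => -[y' z'] [/= h' dz'].
have e := kdeg_factorization h; rewrite (kdeg_factorization h') dz dz' in e.
apply: (factorization_unique h' h); last by rewrite dz dz'.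
apply/ffunP => n; have := congr1 (fun f : {ffun 'I_k -> nat} => f n) e.
by rewrite !ffunE => /addIn.
Qed.

Lemma face1_eq i x y z : is_factorization x (y, z) -> kdeg y = unitdeg i ->
  face1 i x = z.
Proof.
move=> h dy; rewrite /face1; set P := (X in xget _ X).
rewrite (@xget_unique _ (x, x) P (y, z)) // => -[y' z'] [/= h' dy'].
have e := kdeg_factorization h; rewrite (kdeg_factorization h') dy dy' in e.
apply: (factorization_unique h' h); first by rewrite dy dy'.
apply/ffunP => n; have := congr1 (fun f : {ffun 'I_k -> nat} => f n) e.
by rewrite !ffunE => /addnI.
Qed.

End Faces.

Section CrossedProductCubes.
Variables (k : nat) (L : kgraph k) (b : kauto L).
Local Notation X := (xprod b).
Implicit Types (e x mu nu : L) (v : kob L).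

(** The edges of the product graph are those of [L], in the [xedge] copy, and
    one new edge [xvert v] with range [v] and source [aobV b v]. *)
Definition xedge e : X := (e, 0%N).
Definition xvert v : X := (kid L v, 1%N).

Lemma degpair_lift m n (j : 'I_k) : degpair m n (lift ord_max j) = m j.
Proof. by rewrite ffunE liftK. Qed.

Lemma degpair_max (m : {ffun 'I_k -> nat}) n : degpair m n ord_max = n.
Proof. by rewrite ffunE unlift_none. Qed.

Lemma degpair_inj (m m' : {ffun 'I_k -> nat}) n n' :
  degpair m n = degpair m' n' -> m = m' /\ n = n'.
Proof.
move=> e; split; last by rewrite -(degpair_max m n) e degpair_max.
by apply/ffunP => j; rewrite -(degpair_lift m n) e degpair_lift.
Qed.

Lemma unitdeg_lift (j : 'I_k) : unitdeg (lift ord_max j) = degpair (unitdeg j) 0.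
Proof.
apply/ffunP => i; rewrite !ffunE; case: unliftP => [l ->|->].
  by rewrite ffunE (inj_eq lift_inj).
by rewrite (negPf (neq_lift _ _)).
Qed.

Lemma unitdeg_max : unitdeg (@ord_max k) = degpair 0 1.
Proof.
apply/ffunP => i; rewrite !ffunE; case: unliftP => [l ->|->]; last by rewrite eqxx.
by rewrite ffunE eq_sym (negPf (neq_lift _ _)).
Qed.

Lemma xdegE (x : X) : kdeg x = degpair (kdeg (x.1 : L)) x.2.
Proof. by []. Qed.

Lemma ltn_lift_max (i j : 'I_k) : (lift ord_max i < lift ord_max j)%N = (i < j)%N.
Proof. by rewrite !lift_max. Qed.

Variant xunit_spec : 'I_k.+1 -> Prop :=
  | XUnitLift j : xunit_spec (lift ord_max j)
  | XUnitMax : xunit_spec ord_max.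

Lemma xunitP i : xunit_spec i.
Proof. by case: (unliftP ord_max i) => [j|] ->; constructor. Qed.

Lemma xdeg_lift (x : X) j : kdeg x = unitdeg (lift ord_max j) ->
  x = xedge x.1 /\ kdeg (x.1 : L) = unitdeg j.
Proof.
by case: x => x n; rewrite unitdeg_lift xdegE => /degpair_inj[/= -> ->].
Qed.

Lemma xdeg_max (x : X) : kdeg x = unitdeg ord_max -> x = xvert (krng x).
Proof.
case: x => x n; rewrite unitdeg_max xdegE => /degpair_inj[/= d ->].
by congr pair; exact: kdeg_eq0.
Qed.

Lemma xedge_deg e j : kdeg e = unitdeg j -> kdeg (xedge e) = unitdeg (lift ord_max j).
Proof. by move=> d; rewrite unitdeg_lift xdegE d. Qed.

Lemma xvert_deg v : kdeg (xvert v) = unitdeg ord_max.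
Proof. by rewrite unitdeg_max xdegE kdeg_id. Qed.

Lemma xvert_rng v : krng (xvert v) = v.
Proof. exact: krng_id. Qed.

Lemma xvert_src v : ksrc (xvert v) = aobV b v.
Proof. by rewrite -[in RHS](ksrc_id v). Qed.

Lemma xedge_cube e : cubes 1 e -> cubes 1 (xedge e).
Proof. by move=> /cubes1P[i d]; apply/cubes1P; eexists; exact: xedge_deg d. Qed.

Lemma xvert_cube v : cubes 1 (xvert v).
Proof. by apply/cubes1P; exists ord_max; exact: xvert_deg. Qed.

Lemma xcubes1P (x : X) : cubes 1 x ->
  (exists2 e, cubes 1 e & x = xedge e) \/ (exists v, x = xvert v).
Proof.
move=> x1; have [i di] := (@cubes1P _ X x).1 x1; move: di.
case: i / xunitP => [j /xdeg_lift[-> d]|/xdeg_max ->].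
  by left; exists x.1 => //; apply/cubes1P; exists j.
by right; eexists.
Qed.

Lemma kauto_cube e r : cubes r e -> cubes r (b e).
Proof. by rewrite /cubes /= amor_deg. Qed.

Lemma xcube2 e : cubes 1 e -> cubes 2 ((e, 1%N) : X).
Proof.
move=> [e1 es]; split=> [i|].
  by rewrite xdegE; case: i / xunitP => [j|]; rewrite ?degpair_lift ?degpair_max.
rewrite big_ord_recr /= degpair_max.
have -> // : (\sum_(i < k) degpair (kdeg e) 1 (widen_ord (leqnSn k) i))%N = 1%N.
rewrite -[RHS]es; apply: eq_bigr => i _; rewrite -(degpair_lift (kdeg e) 1%N).
congr (degpair _ _ _); apply: val_inj.
by rewrite /= /bump leqNgt ltn_ord.
Qed.

Lemma xpaths_lift v j : @paths_from _ X v (unitdeg (lift ord_max j)) =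
  xedge @` paths_from v (unitdeg j).
Proof.
apply/seteqP; split=> [x [rx /xdeg_lift[xe d]]|_ [e [re d] <-]].
  by exists x.1.
by split; [exact: re | exact: xedge_deg].
Qed.

Lemma xpaths_max v : @paths_from _ X v (unitdeg ord_max) = [set xvert v].
Proof.
apply/seteqP; split=> [x [rx /xdeg_max]|_ ->]; first by rewrite rx.
by split; [exact: xvert_rng | exact: xvert_deg].
Qed.

Lemma xprod_row_finite : row_finite_no_sources L -> row_finite_no_sources X.
Proof.
move=> hL v d; pose m : {ffun 'I_k -> nat} := [ffun j => d (lift ord_max j)].
have -> : d = degpair m (d ord_max).
  by apply/ffunP => i; rewrite !ffunE; case: unliftP => [j|] ->; rewrite ?ffunE.
have [fin [x [rx dx]]] := hL v m.
have -> : @paths_from _ X v (degpair m (d ord_max)) =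
    (fun x => (x, d ord_max) : X) @` @paths_from _ L v m.
  apply/seteqP; split=> [[y n] [ry]|_ [y [ry dy] <-]].
    by rewrite xdegE => /degpair_inj[/= dy <-]; exists y.
  by split; [exact: ry | rewrite xdegE /= dy].
by split; [exact: finite_image | exists (x, d ord_max), x].
Qed.

(** The square (b e, 1) has the new edge on either side of an old one; these
    are its two factorizations. *)
Lemma xcomp_edge_vert x w : ksrc x = w ->
  kcompose (xedge x) (xvert w) = ((x, 1%N) : X).
Proof. by move=> <-; congr pair; exact: kcompose_idr. Qed.

Lemma xcomp_vert_edge e :
  kcompose (xvert (krng (b e))) (xedge e) = ((b e, 1%N) : X).
Proof. by congr pair; exact: kcompose_idl. Qed.

Variables (R : realType) (phi : X -> R[i]).
Hypothesis hphi : cocycle 2 phi.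

Lemma cocycle_norm e : cubes 1 e -> `|phi (e, 1%N)| = 1.
Proof. by move=> e1; apply: hphi.1; exact: xcube2. Qed.

Lemma cocycle_conj e : cubes 1 e -> phi (e, 1%N) * (phi (e, 1%N))^* = 1.
Proof. by move=> /cocycle_norm n1; rewrite -normCK n1 expr1n. Qed.

(** This is the cocycle identity on the cube (b x, 1), where x is the square
    with sides [mu], [nu], [nu'], [mu'].  The faces in the new direction are
    (b x, 0) and (x, 0), and the four others are (b e, 1) for the sides e
    of x. *)
Lemma cocycle_cube (i j : 'I_k) (mu mu' nu nu' : L) : (i < j)%N ->
  kdeg mu = unitdeg i -> kdeg mu' = unitdeg i ->
  kdeg nu = unitdeg j -> kdeg nu' = unitdeg j ->
  ksrc mu = krng nu -> ksrc nu' = krng mu' ->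
  kcompose mu nu = kcompose nu' mu' ->
  phi (b nu', 1%N) * phi (b mu', 1%N) * phi (b (kcompose mu nu), 0%N) =
  phi (kcompose mu nu, 0%N) * (phi (b mu, 1%N) * phi (b nu, 1%N)).
Proof.
move=> ij dmu dmu' dnu dnu' cmn cnm sq; set x := kcompose mu nu.
pose Y : X := (b x, 1%N).
have dx : kdeg x = unitdeg i + unitdeg j by rewrite kdeg_comp // dmu dnu.
have ltij : (lift ord_max i < lift ord_max j)%N by rewrite ltn_lift_max.
set I := lift ord_max i in ltij; set J := lift ord_max j in ltij.
have nIJ : I != J by rewrite -val_eqE /= ltn_eqF.
have nIM : I != ord_max by rewrite eq_sym neq_lift.
have nJM : J != ord_max by rewrite eq_sym neq_lift.
have dY n : kdeg Y n = [|| n == I, n == J | n == ord_max].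
  rewrite xdegE /= amor_deg dx; case: n / xunitP => [l|].
    rewrite degpair_lift !ffunE [lift _ _ == ord_max]eq_sym (negPf (neq_lift _ _)).
    rewrite orbF !(inj_eq lift_inj); case: eqP => [->|_] //=.
    by move: ltij; rewrite ltn_lift_max; case: eqP => [->|//]; rewrite ltnn.
  by rewrite degpair_max eqxx !orbT.
have cubeY : cubes 3 Y.
  split=> [n|]; first by rewrite dY leq_b1.
  rewrite (bigD1 I) // (bigD1 J) 1?eq_sym //= (bigD1 ord_max) /=; last first.
    by rewrite ![ord_max == _]eq_sym nIM nJM.
  rewrite !dY !eqxx /= !orbT big1 // => n /andP[/andP[a c] d].
  by rewrite dY (negPf a) (negPf c) (negPf d).
have bigY (T : Type) (idx : T) (op : Monoid.com_law idx) (G : 'I_k.+1 -> T) :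
    \big[op/idx]_(n < k.+1 | kdeg Y n != 0%N) G n = op (G I) (op (G J) (G ord_max)).
  rewrite (bigD1 I) /= ?dY ?eqxx //; congr (op _ _).
  rewrite (bigD1 J) /= ?dY ?eqxx ?orbT ?[J == I]eq_sym //; congr (op _ _).
  rewrite (bigD1 ord_max) /= ?dY ?eqxx ?orbT ?[ord_max == _]eq_sym ?nIM ?nJM //.
  rewrite big1 ?Monoid.mulm1 // => n; rewrite dY.
  by case: (n == I); case: (n == J); case: (n == ord_max).
have ltjm (l : 'I_k) : (lift ord_max l < @ord_max k)%N by rewrite lift_max /=.
have posY n : dirpos Y n = ((I <= n) + ((J <= n) + (@ord_max k <= n)))%N.
  rewrite /dirpos -sum1_card (eq_bigl (fun m => (kdeg Y m != 0%N) && (m <= n)%N)).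
    by rewrite big_mkcondr bigY; congr (_ + (_ + _))%N; case: leqP.
  by move=> m; apply/idP/idP; rewrite inE /= andbC.
have posI : dirpos Y I = 1%N.
  by rewrite posY leqnn [(J <= I)%N]leqNgt ltij [(@ord_max k <= I)%N]leqNgt ltjm.
have posJ : dirpos Y J = 2%N.
  by rewrite posY leqnn (ltnW ltij) [(@ord_max k <= J)%N]leqNgt ltjm.
have posM : dirpos Y ord_max = 3%N.
  by rewrite posY (ltnW (ltjm i)) (ltnW (ltjm j)) leqnn.
have src1 y z : ksrc y = krng z -> ksrc ((b y, 1%N) : X) = krng (xedge z).
  by move=> e; rewrite /= amor_src aobK.
have split1 y z : ksrc y = krng z -> kcompose y z = x ->
    is_factorization Y ((((b y, 1%N) : X), xedge z) : X * X).
  move=> yz e; split; first exact: src1.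
  by rewrite /Y -e amor_comp.
have split2 y z : ksrc y = krng z -> kcompose y z = x ->
    is_factorization Y ((xedge (b y), ((b z, 1%N) : X)) : X * X).
  by move=> yz e; split; rewrite /= ?amor_src ?amor_rng ?yz // /Y -e amor_comp.
(* In the directions [I] and [J], the other factor of each factorization is an
   edge of the square, moved by [b] exactly when it comes first. *)
have f0I : face0 I Y = (b nu', 1%N).
  by apply: (face0_eq (split1 _ _ cnm _)); [rewrite -sq | exact: xedge_deg].
have f1I : face1 I Y = (b nu, 1%N).
  by apply: (face1_eq (split2 _ _ cmn _)) => //; apply: xedge_deg; rewrite amor_deg.
have f0J : face0 J Y = (b mu, 1%N).
  by apply: (face0_eq (split1 _ _ cmn _)) => //; exact: xedge_deg.
have f1J : face1 J Y = (b mu', 1%N).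
  apply: (face1_eq (split2 _ _ cnm _)); first by rewrite -sq.
  by apply: xedge_deg; rewrite amor_deg.
have f0M : face0 ord_max Y = xedge (b x).
  apply: (@face0_eq _ _ _ _ _ (xvert (ksrc (b x)))); last exact: xvert_deg.
  by split; [rewrite xvert_rng | exact: xcomp_edge_vert].
have f1M : face1 ord_max Y = xedge x.
  apply: (@face1_eq _ _ _ _ (xvert (krng (b x)))); last exact: xvert_deg.
  by split; [rewrite xvert_src /= amor_rng aobK | exact: xcomp_vert_edge].
have := hphi.2 _ cubeY; rewrite /coboundary bigY posI posJ posM.
rewrite !big_ord_recl !big_ord0 !mulr1 /face /= f0I f1I f0J f1J f0M f1M.
have -> : (-1) ^+ (1 + 0) = -1 :> int by [].
have -> : (-1) ^+ (1 + bump 0 0) = 1 :> int by [].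
have -> : (-1) ^+ (2 + bump 0 0) = -1 :> int by [].
have -> : (-1) ^+ (3 + bump 0 0) = 1 :> int by [].
rewrite !exprN1 !expr1z; move: (phi (b nu', _)) (phi (b nu, _)) (phi (b mu, _)).
move: (phi (b mu', _)) (phi (xedge (b x))) (phi (xedge x)) => c3 c4 c5 c0 c1 c2.
(* A value that occurs inverted is nonzero, since the product is 1. *)
have [->|n0] := eqVneq c0 0; first by rewrite invr0 !mul0r => /eqP; rewrite eq_sym oner_eq0.
have [->|n3] := eqVneq c3 0.
  by rewrite invr0 !(mulr0, mul0r) => /eqP; rewrite eq_sym oner_eq0.
have [->|n4] := eqVneq c4 0.
  by rewrite invr0 !(mulr0, mul0r) => /eqP; rewrite eq_sym oner_eq0.
move=> e; rewrite -[LHS]mulr1 -e; field.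
by rewrite n0 n3 n4.
Qed.

End CrossedProductCubes.

(** * Twisting by an automorphism of the graph *)

Program Definition kauto_inv (k : nat) (L : kgraph k) (g : kauto L) : kauto L :=
  @KAuto k L (aobV g) (amorV g) (aob g) g (aobVK g) (aobK g) (amorVK g) (amorK g)
    _ _ _ _ _.
Next Obligation.
by move=> k L g x; apply: (can_inj (aobK g)); rewrite -amor_rng amorVK aobVK.
Qed.
Next Obligation.
by move=> k L g x; apply: (can_inj (aobK g)); rewrite -amor_src amorVK aobVK.
Qed.
Next Obligation.
by move=> k L g v; apply: (can_inj (amorK g)); rewrite amorVK amor_id aobVK.
Qed.
Next Obligation.
move=> k L g x y xy; apply: (can_inj (amorK g)); rewrite amorVK amor_comp ?amorVK //.
by apply: (can_inj (aobK g)); rewrite -amor_rng -amor_src !amorVK.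
Qed.
Next Obligation.
by move=> k L g x; rewrite -[in RHS](amorVK g x) amor_deg.
Qed.

Lemma unit_scale_starl (R : realType) (A : cstarAlgType R) (c : R[i]) (x : A) :
  c * c^* = 1 -> (c *: x)^# ** (c *: x) = x^# ** x.
Proof. by move=> cc; rewrite cstarZ cmulZl cmulZr scalerA mulrC cc scale1r. Qed.

Lemma unit_scale_starr (R : realType) (A : cstarAlgType R) (c : R[i]) (x : A) :
  c * c^* = 1 -> (c *: x) ** (c *: x)^# = x ** x^#.
Proof. by move=> cc; rewrite cstarZ cmulZl cmulZr scalerA cc scale1r. Qed.

(** The condition on the weight [w] is what the rescaled translates of the
    generators need to satisfy the commutation relation of a square.  It
    holds for phi(b e, 1) along [b], and for conjugate weights along the
    inverse of [b]. *)
Lemma twisted_endomorphism (R : realType) (k : nat) (L : kgraph k)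
    (g : kauto L) (psi w : L -> R[i]) (A : cstarAlgType R)
    (p : kob L -> A) (s : L -> A) :
  is_twisted_algebra psi p s ->
  (forall e, cubes 1 e -> w e * (w e)^* = 1) ->
  (forall (i j : 'I_k) (mu mu' nu nu' : L), (i < j)%N ->
     kdeg mu = unitdeg i -> kdeg mu' = unitdeg i ->
     kdeg nu = unitdeg j -> kdeg nu' = unitdeg j ->
     ksrc mu = krng nu -> ksrc nu' = krng mu' ->
     kcompose mu nu = kcompose nu' mu' ->
     w nu' * w mu' * psi (g (kcompose mu nu)) =
     psi (kcompose mu nu) * (w mu * w nu)) ->
  exists f : A -> A, [/\ star_hom f, forall v, f (p v) = p (aob g v)
    & forall e, cubes 1 e -> f (s e) = w e *: s (g e)].
Proof.
case=> ck _ univ w1 wsq; have [[pproj porth] src sq rng] := ck.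
apply: (univ A (p \o aob g) (fun e => w e *: s (g e))); split.
- split=> [v|v u vu]; first exact: pproj.
  by apply: porth; rewrite (inj_eq (can_inj (aobK g))).
- move=> e e1; rewrite unit_scale_starl ?w1 // src /= ?amor_src //.
  exact: kauto_cube.
- move=> i j mu mu' nu nu' ij dmu dmu' dnu dnu' mn nm e.
  rewrite !cmulZl !cmulZr !scalerA -(wsq i j mu mu' nu nu') // -[RHS]scalerA.
  congr (_ *: _); rewrite amor_comp //.
  apply: (sq i j (g mu) (g mu') (g nu) (g nu')); rewrite ?amor_deg //.
  + by rewrite amor_src amor_rng mn.
  + by rewrite amor_src amor_rng nm.
  + by rewrite -!amor_comp // e.
- move=> v i [x [rx dx]] /=.
  rewrite (rng _ i); last by exists (g x); rewrite /paths_from /= amor_rng rx amor_deg.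
  rewrite (reindex_fsbig g (paths_from v (unitdeg i))).
    apply: eq_fsbigr => y; rewrite inE => -[_ dy]; rewrite unit_scale_starr // w1 //.
    by apply/cubes1P; exists i.
  split.
  + by move=> y [/= ry dy]; rewrite /paths_from /= amor_rng ry amor_deg.
  + by move=> y z _ _; exact: (can_inj (amorK g)).
  + move=> y [ry dy]; exists (amorV g y); last exact: amorVK.
    split; last by rewrite -(amor_deg g) amorVK.
    by apply: (can_inj (aobK g)); rewrite -amor_rng amorVK.
Qed.

Lemma invert_weights (K : comPzRingType) (c c' m n m' n' ms ns ms' ns' : K) :
  n' * ns' = 1 -> n * ns = 1 -> m' * ms' = 1 -> m * ms = 1 ->
  n' * m' * c = c' * (m * n) -> ns' * ms' * c' = c * (ms * ns).
Proof.
move=> e1 e2 e3 e4 E.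
have -> : ns' * ms' * c' = ns' * ms' * (c' * (m * n)) * (ms * ns).
  by rewrite -[LHS]mulr1 -[X in _ * X](mulr1 1) -{1}e2 -e4; ring.
rewrite -E.
have -> : ns' * ms' * (n' * m' * c) * (ms * ns) =
    (n' * ns') * (m' * ms') * (c * (ms * ns)) by ring.
by rewrite e1 e3 !mul1r.
Qed.

Section InducedAutomorphismExists.
Variables (R : realType) (k : nat) (L : kgraph k) (b : kauto L).
Variables (phi : xprod b -> R[i]) (hphi : cocycle 2 phi).
Variables (A : cstarAlgType R) (p : kob L -> A) (s : L -> A).
Hypothesis hA : is_twisted_algebra (ipull phi) p s.

Lemma induced_automorphism : exists f : A -> A, is_beta_phi phi p s f.
Proof.
have c1 e : cubes 1 e -> phi (e, 1%N) * (phi (e, 1%N))^* = 1 by exact: cocycle_conj.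
have bc e : cubes 1 e -> cubes 1 (b e) by exact: kauto_cube.
have bVc e : cubes 1 e -> cubes 1 (amorV b e) by exact: (@kauto_cube _ _ (kauto_inv b)).
have [f [hf fp fs]] : exists f : A -> A,
    [/\ star_hom f, forall v, f (p v) = p (aob b v)
      & forall e, cubes 1 e -> f (s e) = phi (b e, 1%N) *: s (b e)].
  apply: (twisted_endomorphism hA) => [e /bc/c1 //|]; exact: cocycle_cube.
have [f' [hf' fp' fs']] : exists f : A -> A,
    [/\ star_hom f, forall v, f (p v) = p (aobV b v)
      & forall e, cubes 1 e -> f (s e) = (phi (e, 1%N))^* *: s (amorV b e)].
  apply: (twisted_endomorphism (g := kauto_inv b) hA) => [e /c1|].
    by rewrite conjCK mulrC.
  move=> i j mu mu' nu nu' ij dmu dmu' dnu dnu' mn nm e /=.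
  have dV y : kdeg (amorV b y) = kdeg y by exact: (amor_deg (kauto_inv b)).
  have rV y : krng (amorV b y) = aobV b (krng y) by exact: (amor_rng (kauto_inv b)).
  have sV y : ksrc (amorV b y) = aobV b (ksrc y) by exact: (amor_src (kauto_inv b)).
  have cV y z : ksrc y = krng z ->
      amorV b (kcompose y z) = kcompose (amorV b y) (amorV b z).
    exact: (amor_comp (kauto_inv b)).
  have := cocycle_cube hphi ij (mu := amorV b mu) (mu' := amorV b mu')
    (nu := amorV b nu) (nu' := amorV b nu').
  rewrite !dV !rV !sV -!cV // !amorVK mn nm e.
  move=> /(_ dmu dmu' dnu dnu' erefl erefl erefl).
  rewrite -e /ipull.
  have cc y l : kdeg y = unitdeg l -> phi (y, 1%N) * (phi (y, 1%N))^* = 1.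
    by move=> d; apply: c1; apply/cubes1P; exists l.
  have := cc _ _ dmu; have := cc _ _ dmu'; have := cc _ _ dnu; have := cc _ _ dnu'.
  move=> e1 e2 e3 e4 E; exact: invert_weights E.
have gen := hA; case: gen => _ gen _.
exists f; split=> //; split=> //; exists f' => x.
  apply: (star_hom_eq gen (star_hom_comp hf hf') (@star_hom_id _ A)).
  move=> _ [[v _ <-]|[e e1 <-]] /=; first by rewrite fp fp' aobK.
  have [_ fZ' _ _] := hf'.
  by rewrite fs // fZ' fs'; [rewrite amorK scalerA c1 ?scale1r //; exact: bc | exact: bc].
apply: (star_hom_eq gen (star_hom_comp hf' hf) (@star_hom_id _ A)).
move=> _ [[v _ <-]|[e e1 <-]] /=; first by rewrite fp' fp aobVK.
have [_ fZ _ _] := hf.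
by rewrite fs' // fZ fs; [rewrite amorVK scalerA mulrC c1 ?scale1r | exact: bVc].
Qed.

End InducedAutomorphismExists.

(** * The implementing unitary *)

Section ImplementingUnitary.
Variables (R : realType) (k : nat) (L : kgraph k) (b : kauto L).
Variable hL : row_finite_no_sources L.
Variables (phi : xprod b -> R[i]) (B : cstarAlgType R).
Variables (q : kob (xprod b) -> B) (t : xprod b -> B).
Hypothesis ck : ck_rep phi q t.

Local Notation T v := (t (xvert b v)).
Let hX := @xprod_row_finite k L b hL.

Lemma vert_mul_star v : T v ** (T v)^# = q v.
Proof.
have [_ _ _ /(_ v ord_max)] := ck.
rewrite xpaths_max fsbig_set1 => -> //.
by exists (xvert b v).
Qed.

Lemma vert_star_mul v : (T v)^# ** T v = q (aobV b v).
Proof. by rewrite (ck_source ck) ?xvert_src //; exact: xvert_cube. Qed.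

Lemma vert_left v : q v ** T v = T v.
Proof. by have := ck_left_unit hX ck (@xvert_cube _ _ b v); rewrite xvert_rng. Qed.

Lemma vert_right v : T v ** q (aobV b v) = T v.
Proof. by have := ck_right_unit ck (@xvert_cube _ _ b v); rewrite xvert_src. Qed.

Lemma vert_mul0 v w : w != aob b v -> T w ** q v = 0.
Proof.
move=> wv; rewrite -vert_right -cmulA (ck_orthogonal ck) ?cmulx0 //.
by apply: contra wv => /eqP <-; rewrite aobVK.
Qed.

Lemma mul_vert0 v w : w != v -> q v ** T w = 0.
Proof.
by move=> wv; rewrite -vert_left cmulA (ck_orthogonal ck) ?cmul0x // eq_sym.
Qed.

(** This is the commutation relation for the square (b e, 1). *)
Lemma edge_commutation e : cubes 1 e ->
  T (krng (b e)) ** t (xedge b e) =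
  phi (b e, 1%N) *: (t (xedge b (b e)) ** T (ksrc (b e))).
Proof.
move=> e1; have [i di] := (@cubes1P _ L e).1 e1.
have sq : kcompose (xedge b (b e)) (xvert b (ksrc (b e))) =
          kcompose (xvert b (krng (b e))) (xedge b e).
  by rewrite xcomp_vert_edge xcomp_edge_vert.
have [_ _ TG2 _] := ck.
rewrite (TG2 (lift ord_max i) ord_max (xedge b (b e)) (xedge b e)
  (xvert b (ksrc (b e))) (xvert b (krng (b e)))) //.
- by rewrite xcomp_edge_vert.
- by rewrite lift_max /=.
- by apply: xedge_deg; rewrite amor_deg.
- exact: xedge_deg.
- exact: xvert_deg.
- exact: xvert_deg.
- by rewrite xvert_rng.
- by rewrite xvert_src amor_rng aobK.
Qed.

Section StrictLimit.
Variables (F : nat -> {fset kob L}) (hF : exhausting F).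
Hypothesis gen : generated_by (range q `|` t @` cubes 1).

Let u n := \sum_(v <- F n) T v.

Lemma partial_sum_vert n v : aob b v \in F n -> u n ** q v = T (aob b v).
Proof.
move=> vF; rewrite cmul_suml (@sum_unique_term _ _ _ _ _ (aob b v)) ?vF ?fset_uniq //.
  by have := vert_right (aob b v); rewrite aobK.
by move=> w; exact: vert_mul0.
Qed.

Lemma vert_partial_sum n v : v \in F n -> q v ** u n = T v.
Proof.
move=> vF; rewrite cmul_sumr (@sum_unique_term _ _ _ _ _ v) ?vF ?vert_left ?fset_uniq //.
by move=> w; exact: mul_vert0.
Qed.

Lemma partial_sum_mul_star n : u n ** (u n)^# = \sum_(v <- F n) q v.
Proof.
rewrite cmul_suml big_seq [RHS]big_seq; apply: eq_bigr => v vF.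
rewrite -[in LHS]vert_right -cmulA -[q _ in LHS](ck_starp ck) -cstarM.
by rewrite partial_sum_vert aobVK // vert_mul_star.
Qed.

Lemma partial_sum_star_mul n :
  (u n)^# ** u n = \sum_(v <- [fset aobV b w | w in F n]%fset) q v.
Proof.
rewrite big_imfset /=; last by move=> v w _ _; exact: (can_inj (aobVK b)).
rewrite cmul_sumr big_seq [RHS]big_seq; apply: eq_bigr => v vF.
rewrite -[in LHS]vert_left cmulA -[q _ in LHS](ck_starp ck) -cstarM.
by rewrite vert_partial_sum // vert_star_mul.
Qed.

Lemma exhausting_preimage : exhausting (fun n => [fset aobV b w | w in F n]%fset).
Proof.
case: hF => mono ex; split=> [m n mn|v].
  apply/fsubsetP => _ /imfsetP[w /= wF ->]; apply/imfsetP; exists w => //.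
  by have /fsubsetP := mono _ _ mn; apply.
have [n vn] := ex (aob b v); exists n; apply/imfsetP; exists (aob b v) => //.
by rewrite aobK.
Qed.

Lemma partial_sum_norm n : `|u n| <= 1.
Proof.
rewrite -(@ler_pXn2r _ 2) ?nnegrE ?normr_ge0 // expr1n -cnorm_star.
by rewrite partial_sum_star_mul projection_norm //; exact: (ck_sum_projection ck).
Qed.

Lemma partial_sum_vert_cvg v : u n ** q v @[n --> \oo] --> T (aob b v).
Proof.
apply: cvg_near_cst; apply: filterS (exhausting_in (aob b v) hF) => n.
exact: partial_sum_vert.
Qed.

Lemma vert_partial_sum_cvg v : q v ** u n @[n --> \oo] --> T v.
Proof.
apply: cvg_near_cst; apply: filterS (exhausting_in v hF) => n.
exact: vert_partial_sum.
Qed.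

(** Convergence is checked on generators, where the sequences are eventually
    constant.  Adjoints of elements and of partial sums are carried along: the
    convergence set is then closed under the star operation, and convergence
    of products on the other side follows by taking adjoints. *)
Lemma partial_sum_cvg a :
  cvg (u n ** a @[n --> \oo]) /\ cvg ((u n)^# ** a @[n --> \oo]).
Proof.
have contr (f : nat -> B) n x y : `|f n| <= 1 -> `|f n ** x - f n ** y| <= `|x - y|.
  move=> f1; rewrite -cmulBr; apply: (le_trans (cnormM _ _)).
  by rewrite -[leRHS]mul1r ler_wpM2r.
pose f n := (u n)^#.
have u1 n : `|u n| <= 1 by exact: partial_sum_norm.
have f1 n : `|f n| <= 1 by rewrite normc_star.
pose S (g : nat -> B) := [set x | cvg (g n ** x @[n --> \oo])] `&`
  [set x | cvg (g n ** x^# @[n --> \oo])].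
have Scl g : (forall n, `|g n| <= 1) -> closed (S g).
  move=> g1; apply: closedI.
    by apply: (@closed_is_cvg _ _ _ (fun n x => g n ** x)) => n x y; exact: contr.
  apply: (@closed_is_cvg _ _ _ (fun n x => g n ** x^#)) => n x y.
  by rewrite -[leRHS]normc_star cstarB; exact: contr.
have cst0 (g : nat -> B) : cvg (g n ** 0 @[n --> \oo]).
  by under eq_fun do rewrite cmulx0; exact: is_cvg_cst.
have cD (g : nat -> B) x y : cvg (g n ** x @[n --> \oo]) ->
    cvg (g n ** y @[n --> \oo]) -> cvg (g n ** (x + y) @[n --> \oo]).
  by move=> cx cy; under eq_fun do rewrite cmulDr; exact: is_cvgD.
have cZ (g : nat -> B) c x : cvg (g n ** x @[n --> \oo]) ->
    cvg (g n ** (c *: x) @[n --> \oo]).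
  by move=> cx; under eq_fun do rewrite cmulZr; exact: is_cvgZr.
have cM (g : nat -> B) x y : cvg (g n ** x @[n --> \oo]) ->
    cvg (g n ** (x ** y) @[n --> \oo]).
  move=> cx; under eq_fun do rewrite cmulA.
  apply: (cvgP (lim (g n ** x @[n --> \oo]) ** y)).
  by apply: cvg_cmul => //; exact: cvg_cst.
have gen_cvg v x : q v ** x = x ->
    cvg (u n ** x @[n --> \oo]) /\ cvg (f n ** x @[n --> \oo]).
  move=> <-; split; apply: cM; first exact: cvgP (@partial_sum_vert_cvg v).
  apply: (cvgP (T v)^#).
  have -> : (fun n => f n ** q v) = (fun n => (q v ** u n)^#).
    by apply/funext => n; rewrite cstarM (ck_starp ck).
  by apply: cvg_cstar; exact: vert_partial_sum_cvg.
suff E : S u `&` S f = setT.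
  by have [[? _] [? _]] : (S u `&` S f) a by rewrite E.
apply: gen; first split.
- by apply: closedI; exact: Scl.
- by split; split; rewrite /= ?cstar0.
- move=> x y [[? ?] [? ?]] [[? ?] [? ?]].
  by split; split; rewrite /= ?cstarD; exact: cD.
- by move=> c x [[? ?] [? ?]]; split; split; rewrite /= ?cstarZ; exact: cZ.
- split=> [x y [[? ?] [? ?]] [[? ?] [? ?]]|x [[? ?] [? ?]]].
    by split; split; rewrite /= ?cstarM; exact: cM.
  by split; split; rewrite /= ?cstarK.
- have both v w x : q v ** x = x -> q w ** x^# = x^# -> (S u `&` S f) x.
    by move=> /gen_cvg[? ?] /gen_cvg[? ?]; split; split.
  move=> _ [[v _ <-]|[x x1 <-]].
    by apply: (both v v); rewrite ?(ck_starp ck) (ck_mulpp ck).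
  apply: (both (krng x) (ksrc x)); first exact: (ck_left_unit hX ck).
  by rewrite -[q _](ck_starp ck) -cstarM (ck_right_unit ck).
Qed.

Lemma implementing_unitary_exists :
  exists U, strict_cvg (fun n => mult_of (u n)) U.
Proof.
apply: strict_limit => a; first by have [] := partial_sum_cvg a.
have -> : (fun n => a ** u n) = (fun n => ((u n)^# ** a^#)^#).
  by apply/funext => n; rewrite cstarM !cstarK.
have [_ c] := partial_sum_cvg a^#.
by apply: (cvgP (lim ((u n)^# ** a^# @[n --> \oo]))^#); exact: cvg_cstar.
Qed.

Section TheUnitary.
Variables (U : multiplier B) (hU : strict_cvg (fun n => mult_of (u n)) U).

Lemma implementing_unitary : mult_unitary U.
Proof.
apply: (strict_limit_unitary partial_sum_norm hU) => a.
  under eq_fun do rewrite partial_sum_star_mul.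
  exact: (ck_approximate_identity hX ck exhausting_preimage gen).
under eq_fun do rewrite partial_sum_mul_star.
exact: (ck_approximate_identity hX ck hF gen).
Qed.

Lemma unitary_vert v : mleft U (q v) = T (aob b v).
Proof.
exact: (cvg_unique (@norm_hausdorff _ B) (hU (q v)).1 (@partial_sum_vert_cvg v)).
Qed.

Lemma vert_unitary v : mright U (q v) = T v.
Proof.
exact: (cvg_unique (@norm_hausdorff _ B) (hU (q v)).2 (@vert_partial_sum_cvg v)).
Qed.

Lemma unitary_Ad_vert v : mult_Ad U (q v) = q (aob b v).
Proof.
apply: (mult_Ad_intertwine implementing_unitary).
by rewrite unitary_vert vert_unitary.
Qed.

Lemma unitary_Ad_edge e : cubes 1 e ->
  mult_Ad U (t (xedge b e)) = phi (b e, 1%N) *: t (xedge b (b e)).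
Proof.
move=> e1; apply: (mult_Ad_intertwine implementing_unitary).
have x1 : cubes 1 (xedge b e) by exact: xedge_cube.
have y1 : cubes 1 (xedge b (b e)) by apply: xedge_cube; exact: kauto_cube.
rewrite -(ck_left_unit hX ck x1) mleftM unitary_vert.
rewrite -[aob b _](amor_rng b e) edge_commutation // mrightZ.
rewrite -[in RHS](ck_right_unit ck y1) mrightM vert_unitary.
by congr (_ *: (_ ** T _)); rewrite amor_src.
Qed.

End TheUnitary.
End StrictLimit.
End ImplementingUnitary.

(** * The crossed product decomposition *)

Section Decomposition.
Variables (R : realType) (k : nat) (L : kgraph k) (b : kauto L).
Variable hL : row_finite_no_sources L.
Variables (phi : xprod b -> R[i]).
Variables (A : cstarAlgType R) (p : kob L -> A) (s : L -> A).
Hypothesis hA : is_twisted_algebra (ipull phi) p s.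
Variables (B : cstarAlgType R) (q : kob (xprod b) -> B) (t : xprod b -> B).
Hypothesis hB : is_twisted_algebra phi q t.

(** The old edges span a copy of [L], whose squares carry the twist
    phi(x, 0). *)
Lemma ck_rep_xedge : ck_rep (ipull phi) q (t \o xedge b).
Proof.
have [[proj src sq rng] _ _] := hB; split=> //.
- by move=> x x1; apply: (src (xedge b x)); exact: xedge_cube.
- move=> i j mu mu' nu nu' ij dmu dmu' dnu dnu' mn nm e.
  apply: (sq (lift ord_max i) (lift ord_max j) (xedge b mu) (xedge b mu')
            (xedge b nu) (xedge b nu')); rewrite ?ltn_lift_max //;
    try exact: xedge_deg.
  by congr pair; exact: e.
- move=> v i [x [rx dx]].
  rewrite (rng v (lift ord_max i)); last by rewrite xpaths_lift; exists (xedge b x), x.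
  rewrite xpaths_lift (reindex_fsbig (xedge b) (paths_from v (unitdeg i))) //.
  by split; [move=> y Py; exists y | move=> y z _ _ [] | ].
Qed.

Lemma inclusion_hom : exists pi : A -> B, [/\ star_hom pi,
  forall v, pi (p v) = q v & forall e, cubes 1 e -> pi (s e) = t (xedge b e)].
Proof. by have [_ _ univ] := hA; exact: univ ck_rep_xedge. Qed.

Section Covariance.
Variables (bphi : A -> A) (hb : is_beta_phi phi p s bphi).
Variables (F : nat -> {fset kob L}) (hF : exhausting F).
Variables (U : multiplier B).
Hypothesis hU :
  strict_cvg (fun n => mult_of (\sum_(v <- F n) t (xvert b v))) U.
Variables (pi : A -> B) (hpi : star_hom pi).
Hypothesis pi_vert : forall v, pi (p v) = q v.
Hypothesis pi_edge : forall e, cubes 1 e -> pi (s e) = t (xedge b e).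

Let hUu : mult_unitary U.
Proof. by have [ck gen _] := hB; exact: (implementing_unitary hL ck hF gen hU). Qed.

(** Both sides of covariance are *-homomorphisms in the element of A, so the
    generators decide. *)
Lemma inclusion_covariant : covariant_pair bphi pi U.
Proof.
split=> // a; rewrite mult_conj_of; congr mult_of.
have [_ genA _] := hA; have [ck gen _] := hB; have [[bh _] bp bs] := hb.
apply: (star_hom_eq genA (star_hom_comp hpi (mult_Ad_star_hom hUu))
  (star_hom_comp bh hpi)) => _ [[v _ <-]|[e e1 <-]] /=.
  by rewrite bp !pi_vert (unitary_Ad_vert hL ck hF gen hU).
have [_ piZ _ _] := hpi.
rewrite bs // piZ !pi_edge //; last exact: kauto_cube.
exact: (unitary_Ad_edge hL ck hF gen hU).
Qed.

Variables (D : cstarAlgType R) (jA : A -> D) (u : multiplier D).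
Hypothesis cov : covariant_pair bphi jA u.

Let hu : mult_unitary u. Proof. by case: cov. Qed.
Let hj : star_hom jA. Proof. by case: cov. Qed.

Lemma covariant_intertwine a : mleft u (jA a) = mright u (jA (bphi a)).
Proof.
have [_ _ /(_ a)] := cov; rewrite mult_conj_of => /(@mult_of_inj _ _) <-.
by rewrite /mult_Ad mright_unitaryVK.
Qed.

(** In the crossed product, the part of the unitary with range [v] takes the
    place of the new edge at [v]. *)
Definition dual_edge (x : xprod b) : D :=
  if x.2 is 0 then jA (s x.1) else mright u (jA (p (krng (x.1 : L)))).

Lemma dual_edge_vert v : dual_edge (xvert b v) = mright u (jA (p v)).
Proof. by rewrite /dual_edge /= krng_id. Qed.

Lemma dual_ck_rep : ck_rep phi (jA \o p) dual_edge.
Proof.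
have [ckA _ _] := hA; have [[bh _] bp bs] := hb.
have [jD jZ jM jS] := hj.
have [[pproj porth] src sq rng] := ckA.
split.
- split=> [v|v w vw] /=; last by rewrite -jM porth // star_hom0.
  by have [pS pM] := pproj v; split; rewrite -?jS -?jM ?pS ?pM.
- move=> x /xcubes1P[[e e1 ->]|[v ->]].
    by rewrite /dual_edge /= -jS -jM src.
  rewrite dual_edge_vert xvert_src /=.
  have E : mright u (jA (p v)) = mleft u (jA (p (aobV b v))).
    by rewrite covariant_intertwine bp aobVK.
  have -> : (mright u (jA (p v)))^# = mleft (mult_star u) (jA (p v)).
    by rewrite /= -jS; have [-> _] := pproj v.
  rewrite -mrightM -mleftM -jM; have [_ ->] := pproj v.
  by rewrite -mleft_mright E mleft_unitaryK.
- move=> I J mu mu' nu nu' IJ dmu dmu' dnu dnu' mn nm.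
  case: I / xunitP IJ dmu dmu' => [i|]; last by rewrite ltnNge -ltnS ltn_ord.
  move=> + /xdeg_lift[emu dmu] /xdeg_lift[emu' dmu'].
  case: J / xunitP dnu dnu' => [j|].
    move=> /xdeg_lift[enu dnu] /xdeg_lift[enu' dnu']; rewrite ltn_lift_max => ij.
    rewrite emu emu' enu enu' in mn nm *; move=> [e].
    rewrite /dual_edge /= -!jM -jZ; congr jA.
    exact: (sq i j).
  (* The square has a new edge on one side: this is the intertwining relation
     of [u] with the edge [s y]. *)
  move=> /xdeg_max enu /xdeg_max enu' _.
  rewrite emu emu' in mn nm *; rewrite enu enu' in mn nm *.
  move: (krng nu) (krng nu') mu.1 mu'.1 dmu dmu' mn nm => w w' x y dx dy.
  rewrite xvert_rng xvert_src => xw w'y; rewrite -[ksrc (xedge b x)]/(ksrc x) in xw.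
  have {w'y} -> : w' = krng (b y).
    by rewrite amor_rng -[krng y]/(krng (xedge b y)) -w'y aobVK.
  rewrite xcomp_vert_edge xcomp_edge_vert // => -[xby].
  rewrite !dual_edge_vert /dual_edge /= xby -xw xby.
  have y1 : cubes 1 y by apply/cubes1P; exists i.
  have by1 : cubes 1 (b y) by exact: kauto_cube.
  rewrite -multiplierP covariant_intertwine bs // -!mrightM -!jM -mrightZ -jZ.
  by rewrite cmulZr (ck_left_unit hL ckA) // (ck_right_unit ckA).
- move=> v I; case: I / xunitP => [i|_].
    rewrite xpaths_lift => -[_ [x [rx dx] _]].
    rewrite (reindex_fsbig (xedge b) (@paths_from _ L v (unitdeg i))).
      rewrite /= (rng v i); last by exists x.
      have fin : finite_set (@paths_from _ L v (unitdeg i)) by have [] := hL v (unitdeg i).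
      rewrite !fsbig_finite //= star_hom_sum //; apply: eq_bigr => y _.
      by rewrite jM jS.
    by split; [move=> y Py; exists y | move=> y z _ _ [] | ].
  rewrite xpaths_max fsbig_set1 dual_edge_vert mright_unitary_star //.
  by rewrite -jS -jM; have [-> ->] := pproj v.
Qed.

Lemma dual_hom : exists g : B -> D, [/\ star_hom g,
  forall v, g (q v) = jA (p v),
  forall e, cubes 1 e -> g (t (xedge b e)) = jA (s e)
  & forall v, g (t (xvert b v)) = mright u (jA (p v))].
Proof.
have [_ _ univ] := hB; have [g [hg gq gt]] := univ _ _ _ dual_ck_rep.
exists g; split=> // [e e1|v]; rewrite gt ?dual_edge_vert //.
  exact: xedge_cube.
exact: xvert_cube.
Qed.

Section Inverse.
Variables (g : B -> D) (hg : star_hom g).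
Hypothesis g_vert : forall v, g (q v) = jA (p v).
Hypothesis g_edge : forall e, cubes 1 e -> g (t (xedge b e)) = jA (s e).
Hypothesis g_xvert : forall v, g (t (xvert b v)) = mright u (jA (p v)).

(** The unitary is not in the algebra, but [g] carries multiplication by it
    to multiplication by [u]: this holds on b P_n, where P_n is an
    approximate identity of sums of vertex projections. *)
Lemma dual_hom_unitary x : g (mright U x) = mright u (g x).
Proof.
have [ck gen _] := hB; have hX := @xprod_row_finite k L b hL.
have [gD gZ gM gS] := hg.
pose P n := \sum_(v <- F n) q v.
have PU n : mright U (P n) = \sum_(v <- F n) t (xvert b v).
  rewrite mright_sum; apply: eq_bigr => v _.
  exact: (vert_unitary hL ck hF hU).
have xP : x ** P n @[n --> \oo] --> x by exact: (ck_approximate_identityr hX ck hF gen).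
have l1 : g (mright U (x ** P n)) @[n --> \oo] --> g (mright U x).
  apply: (cvg_comp _ _ (cvg_comp _ _ xP _)); first exact: mright_unitary_continuous.
  exact: star_hom_continuous.
have l2 : mright u (g (x ** P n)) @[n --> \oo] --> mright u (g x).
  apply: (cvg_comp _ _ (cvg_comp _ _ xP _)); first exact: star_hom_continuous.
  exact: mright_unitary_continuous.
have e : (fun n => g (mright U (x ** P n))) = (fun n => mright u (g (x ** P n))).
  apply/funext => n; rewrite mrightM !gM mrightM; congr (_ ** _).
  rewrite PU /P !(star_hom_sum hg) mright_sum; apply: eq_bigr => v _.
  by rewrite g_xvert g_vert.
rewrite e in l1.
exact: (cvg_unique (@norm_hausdorff _ D) l1 l2).
Qed.

Lemma dual_hom_unitary_star x :
  g (mright (mult_star U) x) = mright (mult_star u) (g x).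
Proof.
by rewrite -[in RHS](mright_unitaryVK hUu x) dual_hom_unitary mright_unitaryK.
Qed.

Lemma dual_hom_pow n x : g (mright (mult_pow U n) x) = mright (mult_pow u n) (g x).
Proof.
case: n => n; first by elim: n x => //= n IH x; rewrite IH dual_hom_unitary.
rewrite /mult_pow; elim: n.+1 x => //= m IH x.
by rewrite IH dual_hom_unitary_star.
Qed.

(** Both composites with the dual map are the identity: on B by evaluation on
    generators, on the crossed product by evaluation on the dense span of the
    jA(a) u^n. *)
Lemma integrated_form_iso f : integrated_form jA u pi U f ->
  dense (range (fun w : seq (A * int) =>
        \sum_(x <- w) mright (mult_pow u x.2) (jA x.1))) ->
  star_iso f.
Proof.
move=> [hf fint] dns; have [_ genA _] := hA; have [_ gen _] := hB.
have gpi : g \o pi =1 jA.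
  apply: (star_hom_eq genA (star_hom_comp hpi hg) hj) => _ [[v _ <-]|[e e1 <-]] /=.
    by rewrite pi_vert g_vert.
  by rewrite pi_edge // g_edge.
have fj a : f (jA a) = pi a by exact: (fint a 0).
have fju a : f (mright u (jA a)) = mright U (pi a) by exact: (fint a 1).
split=> //; exists g => x.
  have cl : closed [set y | (g \o f) y = id y].
    apply: closed_coincidence; last by move=> y; exact: cvg_id.
    by apply: star_hom_continuous; exact: star_hom_comp.
  apply: cl => V Vx; apply: contrapT => ne.
  have Vi : V^°%classic !=set0 by exists x.
  have [y [/interior_subset Vy [w _ wy]]] := dns _ Vi (@open_interior _ V).
  apply: ne; exists y; split=> //=; rewrite -wy !star_hom_sum //.
  by apply: eq_bigr => z _; rewrite fint dual_hom_pow; congr mright; exact: gpi.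
apply: (star_hom_eq gen (star_hom_comp hg hf) (@star_hom_id _ B)).
have [ck _ _] := hB.
move=> _ [[v _ <-]|[y /xcubes1P[[e e1 ->]|[v ->]] <-]] /=.
- by rewrite g_vert fj pi_vert.
- by rewrite g_edge // fj pi_edge.
- by rewrite g_xvert fju pi_vert (vert_unitary hL ck hF hU).
Qed.

End Inverse.
End Covariance.
End Decomposition.

Theorem theorem2p1 (R : realType) (k : nat) (L : kgraph k) (beta : kauto L)
    (phi : xprod beta -> R[i])
    (hL : row_finite_no_sources L) (hphi : cocycle 2 phi)
    (* A = C^*_{i^*(phi)}(L), with generators p and s *)
    (A : cstarAlgType R) (p : kob L -> A) (s : L -> A)
    (hA : is_twisted_algebra (ipull phi) p s)
    (* B = C^*_phi(L x_beta Z), with generators q and t *)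
    (B : cstarAlgType R) (q : kob (xprod beta) -> B) (t : xprod beta -> B)
    (hB : is_twisted_algebra phi q t) :
  (* (i) *)
  (exists bphi : A -> A, is_beta_phi phi p s bphi) /\
  (* (ii) *)
  (forall F : nat -> {fset kob L}, exhausting F ->
    exists U : multiplier B,
      [/\ strict_cvg (fun n => mult_of (\sum_(v <- F n) t (kid L v, 1%N))) U,
          mult_unitary U,
          forall v : kob L, mult_conj U (mult_of (q v)) = mult_of (q (aob beta v))
        & forall e : L, cubes 1 e ->
            mult_conj U (mult_of (t (e, 0%N))) =
            mult_of (phi (beta e, 1%N) *: t (beta e, 0%N))]) /\
  (* (iii) *)
  (forall (bphi : A -> A) (F : nat -> {fset kob L}) (U : multiplier B),
    is_beta_phi phi p s bphi -> exhausting F ->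
    strict_cvg (fun n => mult_of (\sum_(v <- F n) t (kid L v, 1%N))) U ->
    exists pi : A -> B, covariant_pair bphi pi U /\
      forall (D : cstarAlgType R) (jA : A -> D) (u : multiplier D),
        is_crossed_product bphi jA u ->
        exists f : D -> B, integrated_form jA u pi U f /\ star_iso f).
Proof.
split; first exact: induced_automorphism.
have [ck gen _] := hB.
split=> [F hF|bphi F U hb hF hU].
  have [U hU] := implementing_unitary_exists hL ck hF gen.
  exists U; split=> //; first exact: (implementing_unitary hL ck hF gen hU).
    by move=> v; rewrite mult_conj_of (unitary_Ad_vert hL ck hF gen hU).
  by move=> e e1; rewrite mult_conj_of (unitary_Ad_edge hL ck hF gen hU).
have [pi [hpi piv pie]] := inclusion_hom hA hB.
have cov := inclusion_covariant hL hA hB hb hF hU hpi piv pie.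
exists pi; split=> // D jA u [covD dns univ].
have [f hf] := univ _ _ _ cov; exists f; split=> //.
have [g [hg gv ge gx]] := dual_hom hL hA hB hb covD.
exact: (integrated_form_iso hL hA hB hF hU hpi piv pie covD hg gv ge gx hf dns).
Qed.
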